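(* Let $n\in(0,3/2)$ and let $H\in C^1([0,1])\cap C^3((0,1))$ with $H>0$ for $x\in(0,1]$ be the unique solution of $$H^{n-1}\frac{d^3H}{dx^3}=-1+x\ \text{ for } x\in(0,1),\qquad \Big(H,\frac{dH}{dx}\Big)=(0,0)\ \text{ at } x=0,\qquad \frac{dH}{dx}=0\ \text{ at } x=1 .$$ Then $H$ satisfies $$H=\kappa x^2\Big(1+v\big(\kappa^{-n}x^{\beta+1},\kappa^{-n}x^{\beta}\big)\Big)\qquad\text{for } 0\le x\ll 1,$$ where $\kappa>0$ is an $n$-dependent constant, $\beta=3-2n$, and $v=v(x_1,x_2)$ is an analytic and $\kappa$-independent function in a neighborhood of $(x_1,x_2)=(0,0)$ with $v(0,0)=0$ but $v\not\equiv0$. Moreover, the dependence of $v$ on both $x_1$ and $x_2$ is in general non-trivial, i.e. there are admissible parameter values $n$ for which $v$ depends non-trivially on $x_1$ as well as on $x_2$.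
   Context: ''For $0\le x\ll1$'' means: there is a constant $c>0$ such that the assertion holds for all $0\le x\le c$. ''$\kappa$-independent'' means that the function $v$ may depend on $n$ but is not affected by the value of $\kappa$. Existence and uniqueness of the solution of this boundary-value problem in the class $C^1([0,1])\cap C^3((0,1))$ is a known fact that may be presupposed. It is also known that $H=\kappa x^2(1+o(1))$ as $x\searrow0$ for an $n$-dependent constant $\kappa>0$. *)

(* Defs.v *)
From Stdlib Require Import Reals.
From Coquelicot Require Import Coquelicot.
Open Scope R_scope.

(* x^a for x >= 0 and a > 0.  Not [Rpower x a], whose value at x = 0 is 1. *)
Definition rpow (x a : R) : R := if Rlt_dec 0 x then Rpower x a else 0.

(* [f] is represented, on a neighbourhood of the origin, by an absolutely
   convergent power series in two variables (summed by total degree). *)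
Definition analytic_near_origin (f : R -> R -> R) : Prop :=
  exists (a : nat -> nat -> R) (r : R), 0 < r /\
    forall x y : R, Rabs x < r -> Rabs y < r ->
      ex_series (fun k : nat =>
        sum_f_R0 (fun i => Rabs (a i (k - i)%nat * x ^ i * y ^ (k - i))) k) /\
      is_series (fun k : nat =>
        sum_f_R0 (fun i => a i (k - i)%nat * x ^ i * y ^ (k - i)) k) (f x y).

(* The next three predicates concern the germ at the origin: the values of the
   total function [f] away from the origin are irrelevant. *)
Definition not_identically_zero (f : R -> R -> R) : Prop :=
  forall r : R, 0 < r ->
    exists x y : R, Rabs x < r /\ Rabs y < r /\ f x y <> 0.

Definition depends_on_fst (f : R -> R -> R) : Prop :=
  forall r : R, 0 < r ->
    exists x x' y : R,
      Rabs x < r /\ Rabs x' < r /\ Rabs y < r /\ f x y <> f x' y.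

Definition depends_on_snd (f : R -> R -> R) : Prop :=
  forall r : R, 0 < r ->
    exists x y y' : R,
      Rabs x < r /\ Rabs y < r /\ Rabs y' < r /\ f x y <> f x y'.

(* [f] is C^1 on the closed interval [a, b] with derivative [df]; at the
   endpoints the derivative is one-sided. *)
Definition C1_closed (f df : R -> R) (a b : R) : Prop :=
  forall x : R, a <= x <= b ->
    D_in f df (fun y => a <= y <= b) x /\
    continue_in df (fun y => a <= y <= b) x.

(* All orders k <= m are required: as [Derive] is total, [ex_derive_n f m]
   alone does not entail the existence of the lower derivatives. *)
Definition Cm_open (m : nat) (f : R -> R) (a b : R) : Prop :=
  forall x : R, a < x < b ->
    forall k : nat, (k <= m)%nat ->
      ex_derive_n f k x /\ continuous (Derive_n f k) x.

Definition ode_on (n : R) (H : R -> R) (b : R) : Prop :=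
  forall x : R, 0 < x < b ->
    Rpower (H x) (n - 1) * Derive_n H 3 x = -1 + x.

Definition bvp_solution (n : R) (H : R -> R) : Prop :=
  exists dH : R -> R,
    C1_closed H dH 0 1 /\
    Cm_open 3 H 0 1 /\
    (forall x : R, 0 < x <= 1 -> 0 < H x) /\
    ode_on n H 1 /\
    H 0 = 0 /\ dH 0 = 0 /\ dH 1 = 0.

Definition beta (n : R) : R := 3 - 2 * n.

Definition expansion (n : R) (v : R -> R -> R) (kappa : R) (H : R -> R) : Prop :=
  exists c : R, 0 < c /\
    forall x : R, 0 <= x <= c ->
      H x = kappa * x ^ 2 *
        (1 + v (Rpower kappa (- n) * rpow x (beta n + 1))
               (Rpower kappa (- n) * rpow x (beta n))).

(* A positive solution of the differential equation on some (0, d) with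
   h(0) = 0 and h = kappa x^2 (1 + o(1)) as x decreases to 0; in particular
   h'(0) = 0.  No condition is imposed at x = 1, so kappa is a free parameter. *)
Definition local_solution (n kappa : R) (h : R -> R) : Prop :=
  exists d : R, 0 < d /\
    Cm_open 3 h 0 d /\
    (forall x : R, 0 < x < d -> 0 < h x) /\
    ode_on n h d /\
    h 0 = 0 /\
    filterlim (fun x => h x / (kappa * x ^ 2)) (at_right 0) (locally 1).

(* The boundary-value problem fixes kappa in terms of n, so quantifying v before
   kappa would not by itself say that v is unaffected by kappa.  What is meant is
   that the same v serves every value of the leading coefficient kappa. *)
Definition kappa_independent (n : R) (v : R -> R -> R) : Prop :=
  forall (kappa : R) (h : R -> R),
    0 < kappa -> local_solution n kappa h -> expansion n v kappa h.

(* Main.v *)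
(** Let [D = (beta + 1) x1 d/dx1 + beta x2 d/dx2] act on functions of the two arguments
    of [v].  The substitution [H = kappa x^2 (1 + v(x1, x2))] turns the equation into
    [D (D + 1) (D + 2) v = (x1 - x2) (1 + v)^(1 - n)], in which [kappa] no longer
    occurs.  Solving by homogeneous parts [v_k], [u_k] of [v] and [u = (1 + v)^(1 - n)],
    with J.C.P. Miller's recurrence for the power, gives [|v_k|, |u_k| <= B^k] in
    the l1-norm of the coefficients, hence an analytic [v].

    A given local solution [h = kappa x^2 (1 + w)] is compared directly with the partial
    sums of [v]: a function that is [o(x^2)] with third derivative at most [K x^(beta - 1)]
    is at most [K x^(beta + 2) / (beta (beta + 1) (beta + 2))], which makes
    [|w - v| <= S] imply [|w - v| <= S / 2] near 0, so [w = v].  For the boundary-value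
    problem, the second derivative of [H] is decreasing, positive near 0 (otherwise
    [H <= 0]) and bounded there, because [H >= c x^2] makes the third derivative
    integrable; its limit at 0 is [2 kappa]. *)
Require Import Defs.
From Stdlib Require Import Reals Lra Lia Classical.
From Coquelicot Require Import Coquelicot.
Open Scope R_scope.

(** * Homogeneous polynomials in two variables *)

Definition hom (k : nat) (P : nat -> R) (x y : R) : R :=
  sum_f_R0 (fun i => P i * x ^ i * y ^ (k - i)) k.

(** Forms are stored by powers of the first variable, so that [PS_mult] multiplies them. [hom] reads
    the entries up to [k] only, whereas [PS_mult] also propagates later ones, which therefore have
    to vanish. *)
Definition supported (k : nat) (P : nat -> R) : Prop :=
  forall i, (k < i)%nat -> P i = 0.

Lemma sum_zero_tail (f : nat -> R) (k N : nat) :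
  (k <= N)%nat -> (forall i, (k < i)%nat -> f i = 0) ->
  sum_f_R0 f N = sum_f_R0 f k.
Proof.
  intros H Hf. induction H as [|N H IH]; [easy|].
  simpl. rewrite IH, Hf; [ring | lia].
Qed.

Lemma sum_zero (f : nat -> R) (N : nat) :
  (forall i, (i <= N)%nat -> f i = 0) -> sum_f_R0 f N = 0.
Proof.
  intros Hf. rewrite (sum_eq _ (fun _ => 0)) by exact Hf.
  rewrite sum_cte. ring.
Qed.

Lemma PS_mult_supported (k l : nat) (P Q : nat -> R) :
  supported k P -> supported l Q -> supported (k + l) (PS_mult P Q).
Proof.
  intros HP HQ i Hi. apply sum_zero. intros j Hj.
  destruct (Nat.le_gt_cases j k) as [H|H].
  - rewrite HQ by lia. ring.
  - rewrite HP by lia. ring.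
Qed.

Lemma hom_mult (k l : nat) (P Q : nat -> R) (x y : R) :
  supported k P -> supported l Q ->
  hom (k + l) (PS_mult P Q) x y = hom k P x y * hom l Q x y.
Proof.
  intros HP HQ. unfold hom.
  destruct (Nat.eq_dec (k + l) 0) as [H0|H0].
  { assert (k = 0%nat) by lia. assert (l = 0%nat) by lia. subst.
    unfold PS_mult. simpl. ring. }
  rewrite <- (sum_zero_tail (fun i => P i * x ^ i * y ^ (k - i)) k (k + l))
    by (lia || (intros i Hi; rewrite HP by easy; ring)).
  rewrite <- (sum_zero_tail (fun i => Q i * x ^ i * y ^ (l - i)) l (k + l))
    by (lia || (intros i Hi; rewrite HQ by easy; ring)).
  rewrite cauchy_finite by lia.
  (* In each product of the remainder of [cauchy_finite] the two indices add up to more than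
     [k + l], so one factor lies beyond its support. *)
  match goal with |- _ = _ + ?r => replace r with 0 end.
  2:{ symmetry. apply sum_zero. intros i Hi. apply sum_zero. intros j Hj.
      destruct (Nat.le_gt_cases (S (j + i)) k) as [H|H].
      - rewrite (HQ (k + l - j)%nat) by lia. ring.
      - rewrite (HP (S (j + i))) by lia. ring. }
  rewrite Rplus_0_r. apply sum_eq. intros i Hi.
  unfold PS_mult. rewrite Rmult_assoc, (Rmult_comm (sum_f_R0 _ _)), scal_sum.
  apply sum_eq. intros j Hj.
  destruct (Nat.le_gt_cases j k) as [H|H].
  2:{ rewrite HP by lia. ring. }
  destruct (Nat.le_gt_cases (i - j) l) as [H'|H'].
  2:{ rewrite HQ by lia. ring. }
  replace (x ^ i) with (x ^ j * x ^ (i - j)) by (rewrite <- pow_add; f_equal; lia).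
  replace (y ^ (k + l - i)) with (y ^ (k - j) * y ^ (l - (i - j)))
    by (rewrite <- pow_add; f_equal; lia).
  ring.
Qed.

Definition hom_norm (k : nat) (P : nat -> R) : R := sum_f_R0 (fun i => Rabs (P i)) k.

Lemma hom_norm_pos (k : nat) (P : nat -> R) : 0 <= hom_norm k P.
Proof. apply cond_pos_sum. intros. apply Rabs_pos. Qed.

(** The norm is the value at [(1, 1)] of the form with coefficients [Rabs (P i)], so [hom_mult] and
    the triangle inequality suffice. *)
Lemma hom_norm_mult (k l : nat) (P Q : nat -> R) :
  supported k P -> supported l Q ->
  hom_norm (k + l) (PS_mult P Q) <= hom_norm k P * hom_norm l Q.
Proof.
  intros HP HQ.
  assert (E : forall m p, hom_norm m p = hom m (fun i => Rabs (p i)) 1 1).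
  { intros m p. apply sum_eq. intros i _. rewrite !pow1. ring. }
  rewrite (E k), (E l), <- hom_mult.
  2,3: intros i Hi; first [rewrite HP by easy | rewrite HQ by easy]; apply Rabs_R0.
  unfold hom. apply sum_Rle. intros i _. rewrite !pow1, !Rmult_1_r.
  unfold PS_mult. eapply Rle_trans; [apply sum_f_R0_triangle|].
  right. apply sum_eq. intros j _. apply Rabs_mult.
Qed.

Lemma hom_bound_abs (k : nat) (P : nat -> R) (x y r : R) :
  Rabs x <= r -> Rabs y <= r ->
  sum_f_R0 (fun i => Rabs (P i * x ^ i * y ^ (k - i))) k <= hom_norm k P * r ^ k.
Proof.
  intros Hx Hy. unfold hom_norm. rewrite (Rmult_comm _ (r ^ k)), scal_sum.
  apply sum_Rle. intros i Hi.
  rewrite !Rabs_mult, Rmult_assoc. apply Rmult_le_compat_l; [apply Rabs_pos|].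
  replace (r ^ k) with (r ^ i * r ^ (k - i)) by (rewrite <- pow_add; f_equal; lia).
  rewrite <- !RPow_abs.
  apply Rmult_le_compat; try (apply pow_le, Rabs_pos);
    apply pow_incr; split; auto using Rabs_pos.
Qed.

Lemma hom_bound (k : nat) (P : nat -> R) (x y r : R) :
  Rabs x <= r -> Rabs y <= r -> Rabs (hom k P x y) <= hom_norm k P * r ^ k.
Proof.
  intros Hx Hy. eapply Rle_trans; [apply sum_f_R0_triangle|].
  now apply hom_bound_abs.
Qed.

Lemma hom_scal (k : nat) (P : nat -> R) (t x y : R) :
  hom k P (t * x) (t * y) = t ^ k * hom k P x y.
Proof.
  unfold hom. rewrite scal_sum. apply sum_eq. intros i Hi.
  rewrite !Rpow_mult_distr.
  replace (t ^ k) with (t ^ i * t ^ (k - i)) by (rewrite <- pow_add; f_equal; lia).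
  ring.
Qed.

Lemma sum_exchange (f : nat -> nat -> R) (m k : nat) :
  sum_f_R0 (fun i => sum_f_R0 (f i) m) k = sum_f_R0 (fun j => sum_f_R0 (fun i => f i j) k) m.
Proof.
  induction k as [|k IH]; simpl; [easy|]. rewrite IH. symmetry. apply plus_sum.
Qed.

Lemma hom_lincomb (k m : nat) (c : nat -> R) (P : nat -> nat -> R) (x y : R) :
  hom k (fun i => sum_f_R0 (fun j => c j * P j i) m) x y =
  sum_f_R0 (fun j => c j * hom k (P j) x y) m.
Proof.
  unfold hom.
  rewrite (sum_eq _ (fun i => sum_f_R0 (fun j => c j * (P j i * x ^ i * y ^ (k - i))) m)).
  - rewrite sum_exchange. apply sum_eq. intros j _. rewrite scal_sum.
    apply sum_eq. intros; ring.
  - intros i _. rewrite (Rmult_assoc (sum_f_R0 _ _)), (Rmult_comm (sum_f_R0 _ _)), scal_sum.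
    apply sum_eq. intros; ring.
Qed.

Lemma hom_norm_lincomb (k m : nat) (c : nat -> R) (P : nat -> nat -> R) :
  hom_norm k (fun i => sum_f_R0 (fun j => c j * P j i) m) <=
  sum_f_R0 (fun j => Rabs (c j) * hom_norm k (P j)) m.
Proof.
  unfold hom_norm.
  eapply Rle_trans.
  { apply sum_Rle. intros i _. apply sum_f_R0_triangle. }
  rewrite sum_exchange. right. apply sum_eq. intros j _. rewrite scal_sum.
  apply sum_eq. intros i _. rewrite Rabs_mult. ring.
Qed.

(** * The power series *)

(* The third derivative of [x ^ (s + 2)] is [indicial s * x ^ (s - 1)]. *)
Definition indicial (s : R) : R := s * (s + 1) * (s + 2).

(* Coefficients of the linear form [x1 - x2], by power of [x1]. *)
Definition lin_diff (i : nat) : R :=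
  match i with O => -1 | S O => 1 | _ => 0 end.

(** A monomial [x1 ^ i * x2 ^ (S j - i)] is an eigenvector of [D] with eigenvalue [(beta + 1) i +
    beta (S j - i) = beta (S j) + i]. Division by [indicial] of it inverts [D (D + 1) (D + 2)] on
    degree [S j]; [P] stands for the part of degree [j] of [(1 + v) ^ (1 - n)]. *)
Definition vstep (n : R) (j : nat) (P : nat -> R) (i : nat) : R :=
  PS_mult lin_diff P i / indicial (beta n * INR (S j) + INR i).

(* Comparing coefficients in [(1 + v) u' = (1 - n) v' u] along rays gives
   [(k + 1) u_(k+1) = sum_j ((1 - n) (j + 1) - (k - j)) v_(j+1) u_(k-j)]. *)
Definition miller (n : R) (k j : nat) : R :=
  ((1 - n) * INR (S j) - INR (k - j)) / INR (S k).

Definition ustep (n : R) (k : nat) (U : nat -> nat -> R) (i : nat) : R :=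
  sum_f_R0 (fun j => miller n k j * PS_mult (vstep n j (U j)) (U (k - j)%nat) i) k.

(* Course-of-values recursion: [uhist n k m] is the part [u_m] for every [m <= k]. *)
Fixpoint uhist (n : R) (k : nat) : nat -> nat -> R :=
  match k with
  | O => fun _ i => match i with O => 1 | _ => 0 end
  | S k' => fun m => if Compare_dec.le_dec m k' then uhist n k' m else ustep n k' (uhist n k')
  end.

(* Coefficient of [x1 ^ i * x2 ^ (k - i)] in [(1 + v) ^ (1 - n)]. *)
Definition ucoef (n : R) (k : nat) : nat -> R := uhist n k k.

(* Coefficient of [x1 ^ i * x2 ^ (k - i)] in [v]. *)
Definition vcoef (n : R) (k : nat) : nat -> R :=
  match k with O => fun _ => 0 | S j => vstep n j (ucoef n j) end.

Lemma uhist_stable (n : R) (k m : nat) : (m <= k)%nat -> uhist n k m = ucoef n m.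
Proof.
  intros H. induction H as [|k H IH]; [easy|].
  simpl. destruct (Compare_dec.le_dec m k); [easy | lia].
Qed.

Lemma ucoef_S (n : R) (k i : nat) :
  ucoef n (S k) i =
  sum_f_R0 (fun j => miller n k j * PS_mult (vcoef n (S j)) (ucoef n (k - j)) i) k.
Proof.
  unfold ucoef at 1. simpl uhist.
  destruct (Compare_dec.le_dec (S k) k); [lia|].
  apply sum_eq. intros j Hj. simpl vcoef.
  now rewrite !uhist_stable by lia.
Qed.

Lemma lin_diff_supported : supported 1 lin_diff.
Proof. intros [|[|i]] H; simpl; lia || easy. Qed.

Lemma vstep_supported (n : R) (k : nat) (P : nat -> R) :
  supported k P -> supported (S k) (vstep n k P).
Proof.
  intros HP i Hi. unfold vstep.
  rewrite (PS_mult_supported 1 k) by (assumption || apply lin_diff_supported).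
  apply Rmult_0_l.
Qed.

Lemma ucoef_supported (n : R) (k : nat) : supported k (ucoef n k).
Proof.
  induction k as [k IH] using (well_founded_induction Wf_nat.lt_wf).
  destruct k as [|k].
  - intros [|i] Hi; [lia | easy].
  - intros i Hi. rewrite ucoef_S. apply sum_zero. intros j Hj.
    rewrite (PS_mult_supported (S j) (k - j)); [ring| | |lia].
    + apply vstep_supported, IH. lia.
    + apply IH. lia.
Qed.

Lemma vcoef_supported (n : R) (k : nat) : supported k (vcoef n k).
Proof.
  destruct k as [|k]; [easy|]. apply vstep_supported, ucoef_supported.
Qed.

(** * Geometric growth of the coefficients *)

Lemma beta_pos (n : R) : 0 < n < 3 / 2 -> 0 < beta n.
Proof. unfold beta; lra. Qed.

Lemma exponent_pos (n : R) (j i : nat) :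
  0 < n < 3 / 2 -> 0 < beta n * INR (S j) <= beta n * INR (S j) + INR i.
Proof.
  intros H. assert (Hb := beta_pos n H). assert (0 < INR (S j)) by (apply lt_0_INR; lia).
  assert (0 <= INR i) by apply pos_INR. nra.
Qed.

Lemma indicial_pos (s : R) : 0 < s -> 0 < indicial s.
Proof. intros H. unfold indicial. repeat apply Rmult_lt_0_compat; lra. Qed.

Lemma indicial_ge (s t : R) : 0 < s <= t -> 2 * s ^ 2 <= indicial t.
Proof. intros H. unfold indicial. nra. Qed.

(** The eigenvalues in degree [S k] are at least [beta n * INR (S k)], so inverting the operator
    gains a factor quadratic in the degree. The norm 2 of [lin_diff] cancels the 2 of [indicial_ge].
    The factors [/ INR (S k) ^ 2] are summable, which is what closes the induction in
    [ucoef_growth]. *)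
Lemma vcoef_hom_norm (n : R) (k : nat) : 0 < n < 3 / 2 ->
  hom_norm (S k) (vcoef n (S k)) <= / (beta n) ^ 2 * hom_norm k (ucoef n k) / INR (S k) ^ 2.
Proof.
  intros Hn. simpl vcoef.
  assert (Hb := beta_pos n Hn). assert (Hk : 0 < INR (S k)) by (apply lt_0_INR; lia).
  assert (Hm := hom_norm_mult 1 k lin_diff (ucoef n k) lin_diff_supported (ucoef_supported n k)).
  assert (E : hom_norm 1 lin_diff = 2).
  { unfold hom_norm, lin_diff. simpl. rewrite Rabs_R1, Rabs_left; lra. }
  rewrite E in Hm. simpl Nat.add in Hm.
  set (C := / (2 * (beta n * INR (S k)) ^ 2)).
  assert (HC : 0 < (beta n * INR (S k)) ^ 2) by (apply pow_lt; nra).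
  apply Rle_trans with (C * hom_norm (S k) (PS_mult lin_diff (ucoef n k))).
  - unfold hom_norm. rewrite scal_sum. apply sum_Rle. intros i _.
    unfold vstep, Rdiv. rewrite Rabs_mult. apply Rmult_le_compat_l; [apply Rabs_pos|].
    destruct (exponent_pos n k i Hn) as [H1 H2].
    rewrite Rabs_pos_eq.
    + apply Rinv_le_contravar; [lra|]. now apply indicial_ge.
    + left. apply Rinv_0_lt_compat, indicial_pos. lra.
  - apply Rle_trans with (C * (2 * hom_norm k (ucoef n k))).
    + apply Rmult_le_compat_l; [|easy]. left. apply Rinv_0_lt_compat. lra.
    + right. unfold C. field. lra.
Qed.

(** Since [Rabs (1 - n) <= 1], the numerator lies between [- (j + 1) - (k - j) = - (k + 1)] and
    [j + 1 <= k + 1]. *)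
Lemma miller_bound (n : R) (k j : nat) :
  0 < n < 3 / 2 -> (j <= k)%nat -> Rabs (miller n k j) <= 1.
Proof.
  intros Hn Hj. unfold miller.
  rewrite minus_INR, !S_INR by easy.
  assert (0 <= INR j) by apply pos_INR. assert (INR j <= INR k) by now apply le_INR.
  unfold Rdiv. rewrite Rabs_mult, (Rabs_pos_eq (/ _)) by (left; apply Rinv_0_lt_compat; lra).
  apply Rle_div_l; [lra|]. apply Rabs_le. nra.
Qed.

(** Telescoping, from [/ (a + 1) ^ 2 <= / a - / (a + 1)]. *)
Lemma sum_inv_sqr (k : nat) :
  sum_f_R0 (fun j => / INR (S j) ^ 2) k <= 2 - / INR (S k).
Proof.
  induction k as [|k IH].
  - simpl. lra.
  - rewrite tech5.
    enough (/ INR (S (S k)) ^ 2 <= / INR (S k) - / INR (S (S k))) by lra.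
    rewrite (S_INR (S k)).
    assert (Hk : 0 < INR (S k)) by (apply lt_0_INR; lia).
    set (a := INR (S k)) in *.
    replace (/ a - / (a + 1)) with (/ (a * (a + 1))) by (field; lra).
    apply Rinv_le_contravar; nra.
Qed.

(** One step of the recursion for [ucoef] costs [2 / beta n ^ 2]: the constant of [vcoef_hom_norm]
    times the bound 2 on the sum of inverse squares. The summand 1 keeps the ratio above 1. *)
Definition growth (n : R) : R := 1 + 2 / (beta n) ^ 2.

Lemma growth_ge1 (n : R) : 0 < n < 3 / 2 -> 1 < growth n.
Proof.
  intros Hn. unfold growth. assert (Hb := beta_pos n Hn).
  assert (0 < 2 / beta n ^ 2); [|lra].
  apply Rdiv_lt_0_compat; [lra|]. now apply pow_lt.
Qed.

(** Strong induction on the degree. In the recurrence for degree [S k], the two norms in the [j]-th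
    product contribute [growth ^ j] and [growth ^ (k - j)], so the term is at most
    [growth ^ k / (beta ^ 2 * (j + 1) ^ 2)], and the sum over [j] at most
    [2 * growth ^ k / beta ^ 2]. *)
Lemma ucoef_growth (n : R) (k : nat) : 0 < n < 3 / 2 ->
  hom_norm k (ucoef n k) <= growth n ^ k.
Proof.
  intros Hn. assert (Hb := beta_pos n Hn). assert (HB := growth_ge1 n Hn).
  assert (HA : 0 < / beta n ^ 2) by now apply Rinv_0_lt_compat, pow_lt.
  induction k as [k IH] using (well_founded_induction Wf_nat.lt_wf).
  destruct k as [|k].
  { unfold hom_norm, ucoef. simpl. rewrite Rabs_R1. lra. }
  assert (E : hom_norm (S k) (ucoef n (S k)) =
    hom_norm (S k) (fun i => sum_f_R0 (fun j => miller n k j * PS_mult (vcoef n (S j)) (ucoef n (k - j)) i) k)).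
  { apply sum_eq. intros i _. now rewrite ucoef_S. }
  rewrite E.
  eapply Rle_trans; [apply (hom_norm_lincomb (S k) k (miller n k) (fun j => PS_mult (vcoef n (S j)) (ucoef n (k - j))))|].
  apply Rle_trans with (sum_f_R0 (fun j => / INR (S j) ^ 2 * (/ beta n ^ 2 * growth n ^ k)) k).
  - apply sum_Rle. intros j Hj.
    assert (H1 := miller_bound n k j Hn Hj).
    assert (H2 := hom_norm_mult (S j) (k - j) (vcoef n (S j)) (ucoef n (k - j))
                    (vcoef_supported n (S j)) (ucoef_supported n (k - j))).
    replace (S j + (k - j))%nat with (S k) in H2 by lia.
    assert (H3 := vcoef_hom_norm n j Hn).
    assert (H4 := IH j ltac:(lia)). assert (H5 := IH (k - j)%nat ltac:(lia)).
    assert (H6 : 0 < / INR (S j) ^ 2) by (apply Rinv_0_lt_compat, pow_lt, lt_0_INR; lia).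
    assert (P1 := hom_norm_pos (S k) (PS_mult (vcoef n (S j)) (ucoef n (k - j)))).
    assert (P2 := hom_norm_pos (S j) (vcoef n (S j))).
    assert (P3 := hom_norm_pos (k - j) (ucoef n (k - j))).
    assert (P4 := hom_norm_pos j (ucoef n j)).
    replace (growth n ^ k) with (growth n ^ j * growth n ^ (k - j))
      by (rewrite <- pow_add; f_equal; lia).
    apply Rle_trans with (1 * (hom_norm (S j) (vcoef n (S j)) * hom_norm (k - j) (ucoef n (k - j)))).
    { apply Rmult_le_compat; auto using Rabs_pos. }
    rewrite Rmult_1_l.
    replace (/ INR (S j) ^ 2 * (/ beta n ^ 2 * (growth n ^ j * growth n ^ (k - j))))
      with ((/ beta n ^ 2 * growth n ^ j / INR (S j) ^ 2) * growth n ^ (k - j)).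
    2:{ unfold Rdiv. ring. }
    apply Rmult_le_compat; auto.
    eapply Rle_trans; [exact H3|]. unfold Rdiv.
    apply Rmult_le_compat_r; [lra|]. apply Rmult_le_compat_l; lra.
  - rewrite <- scal_sum. assert (Hs := sum_inv_sqr k).
    assert (0 < / INR (S k)) by (apply Rinv_0_lt_compat, lt_0_INR; lia).
    assert (0 < growth n ^ k) by (apply pow_lt; lra).
    apply Rle_trans with (/ beta n ^ 2 * growth n ^ k * 2).
    + apply Rmult_le_compat_l; [|lra]. apply Rmult_le_pos; lra.
    + change (growth n ^ S k) with (growth n * growth n ^ k).
      replace (growth n * growth n ^ k)
        with (growth n ^ k + / beta n ^ 2 * growth n ^ k * 2) by (unfold growth at 3, Rdiv; ring).
      lra.
Qed.

Lemma vcoef_growth (n : R) (k : nat) : 0 < n < 3 / 2 ->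
  hom_norm k (vcoef n k) <= growth n ^ k.
Proof.
  intros Hn. assert (HB := growth_ge1 n Hn).
  destruct k as [|k].
  { unfold hom_norm. simpl. rewrite Rabs_R0. lra. }
  eapply Rle_trans; [apply vcoef_hom_norm, Hn|].
  assert (H1 := ucoef_growth n k Hn). assert (P := hom_norm_pos k (ucoef n k)).
  assert (Hb := beta_pos n Hn).
  assert (HA : 0 < / beta n ^ 2) by now apply Rinv_0_lt_compat, pow_lt.
  assert (HS : / INR (S k) ^ 2 <= 1).
  { rewrite <- Rinv_1. apply Rinv_le_contravar; [lra|].
    assert (1 <= INR (S k)) by (change 1 with (INR 1); apply le_INR; lia). nra. }
  assert (H6 : 0 < / INR (S k) ^ 2) by (apply Rinv_0_lt_compat, pow_lt, lt_0_INR; lia).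
  assert (/ beta n ^ 2 <= growth n) by (unfold growth, Rdiv; lra).
  unfold Rdiv. rewrite <- (Rmult_1_r (growth n ^ S k)).
  apply Rmult_le_compat; [apply Rmult_le_pos; lra | lra | | lra].
  change (growth n ^ S k) with (growth n * growth n ^ k).
  apply Rmult_le_compat; lra.
Qed.

(** * Values of the homogeneous parts and sum of the series *)

Definition uhom (n : R) (x y : R) (k : nat) : R := hom k (ucoef n k) x y.
Definition vhom (n : R) (x y : R) (k : nat) : R := hom k (vcoef n k) x y.

Lemma uhom_S (n x y : R) (k : nat) :
  uhom n x y (S k) =
  sum_f_R0 (fun j => miller n k j * (vhom n x y (S j) * uhom n x y (k - j))) k.
Proof.
  unfold uhom at 1.
  transitivity (hom (S k) (fun i => sum_f_R0 (fun j => miller n k j * PS_mult (vcoef n (S j)) (ucoef n (k - j)) i) k) x y).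
  { apply sum_eq. intros i _. now rewrite ucoef_S. }
  rewrite (hom_lincomb (S k) k (miller n k) (fun j => PS_mult (vcoef n (S j)) (ucoef n (k - j)))).
  apply sum_eq. intros j Hj. f_equal. unfold vhom, uhom.
  rewrite <- hom_mult by (apply vcoef_supported || apply ucoef_supported).
  f_equal. lia.
Qed.

Lemma uhom_0 (n x y : R) : uhom n x y 0 = 1.
Proof. unfold uhom, hom. simpl. unfold ucoef. simpl. ring. Qed.

Lemma vhom_0 (n x y : R) : vhom n x y 0 = 0.
Proof. unfold vhom, hom. simpl. ring. Qed.

Lemma hom_lin_diff (n x y : R) (k : nat) :
  hom (S k) (PS_mult lin_diff (ucoef n k)) x y = (x - y) * uhom n x y k.
Proof.
  change (S k) with (1 + k)%nat.
  rewrite hom_mult by (apply ucoef_supported || apply lin_diff_supported).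
  unfold uhom. f_equal. unfold hom. simpl. ring.
Qed.

Lemma geom_dominated_ex (a : nat -> R) (q : R) :
  0 <= q <= 1 / 2 -> (forall k, Rabs (a k) <= q ^ k) -> ex_series a.
Proof.
  intros Hq Ha. apply (@ex_series_le R_AbsRing R_CompleteNormedModule) with (b := fun k => q ^ k).
  - exact Ha.
  - apply ex_series_geom. rewrite Rabs_pos_eq; lra.
Qed.

(** The geometric tail is [q ^ S N / (1 - q)], and [q <= 1 / 2] bounds [/ (1 - q)] by 2. *)
Lemma geom_dominated_tail (a : nat -> R) (q : R) (N : nat) :
  0 <= q <= 1 / 2 -> (forall k, Rabs (a k) <= q ^ k) ->
  Rabs (Series a - sum_f_R0 a N) <= 2 * q ^ S N.
Proof.
  intros Hq Ha.
  rewrite (Series_incr_n a (S N)); [|lia|now apply geom_dominated_ex with q].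
  simpl pred.
  match goal with |- Rabs ?z <= _ =>
    replace z with (Series (fun k => a (S N + k)%nat)) by ring end.
  assert (Hg : ex_series (fun k => q ^ k)) by (apply ex_series_geom; rewrite Rabs_pos_eq; lra).
  assert (Hg' : ex_series (fun k => q ^ S N * q ^ k)) by exact (ex_series_scal_l (q ^ S N) (fun k => q ^ k) Hg).
  assert (Hb : forall k, Rabs (a (S N + k)%nat) <= q ^ S N * q ^ k).
  { intros k. rewrite <- pow_add. apply Ha. }
  eapply Rle_trans; [apply Series_Rabs|].
  { apply (@ex_series_le R_AbsRing R_CompleteNormedModule) with (2 := Hg').
    intros k. unfold norm. simpl. unfold abs. simpl. rewrite Rabs_Rabsolu. apply Hb. }
  eapply Rle_trans; [apply Series_le with (2 := Hg')|].
  { intros k. split; [apply Rabs_pos | apply Hb]. }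
  rewrite Series_scal_l, Series_geom by (rewrite Rabs_pos_eq; lra).
  rewrite Rmult_comm. apply Rmult_le_compat_r; [apply pow_le; lra|].
  rewrite <- (Rinv_inv 2). apply Rinv_le_contravar; lra.
Qed.

Definition vser (n x y : R) : R := Series (vhom n x y).

(** For arguments up to [rho n] the parts of degree [k] are at most [(/ 4) ^ k]. This gives
    [Rabs (vser n x y) <= 1 / 2], so that [1 + vser n x y] stays positive. *)
Definition rho (n : R) : R := / (4 * growth n).

Lemma rho_pos (n : R) : 0 < n < 3 / 2 -> 0 < rho n.
Proof. intros Hn. assert (H := growth_ge1 n Hn). apply Rinv_0_lt_compat. lra. Qed.

Lemma growth_rho (n : R) : 0 < n < 3 / 2 -> growth n * rho n = / 4.
Proof. intros Hn. assert (H := growth_ge1 n Hn). unfold rho. field. lra. Qed.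

Lemma vhom_bound (n x y r : R) (k : nat) : 0 < n < 3 / 2 ->
  Rabs x <= r -> Rabs y <= r -> Rabs (vhom n x y k) <= (growth n * r) ^ k.
Proof.
  intros Hn Hx Hy. eapply Rle_trans; [apply hom_bound; eassumption|].
  rewrite Rpow_mult_distr. apply Rmult_le_compat_r.
  - apply pow_le. eapply Rle_trans; [apply Rabs_pos | exact Hx].
  - now apply vcoef_growth.
Qed.

Lemma uhom_bound (n x y r : R) (k : nat) : 0 < n < 3 / 2 ->
  Rabs x <= r -> Rabs y <= r -> Rabs (uhom n x y k) <= (growth n * r) ^ k.
Proof.
  intros Hn Hx Hy. eapply Rle_trans; [apply hom_bound; eassumption|].
  rewrite Rpow_mult_distr. apply Rmult_le_compat_r.
  - apply pow_le. eapply Rle_trans; [apply Rabs_pos | exact Hx].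
  - now apply ucoef_growth.
Qed.

Lemma vser_analytic (n : R) : 0 < n < 3 / 2 -> analytic_near_origin (vser n).
Proof.
  (* The definition of analyticity indexes coefficients by the two exponents, [vcoef] by total
     degree and first exponent. *)
  intros Hn. exists (fun i j => vcoef n (i + j) i), (rho n).
  assert (Hr := rho_pos n Hn). assert (Hg := growth_rho n Hn). assert (HB := growth_ge1 n Hn).
  split; [easy|]. intros x y Hx Hy. split.
  - apply (@ex_series_le R_AbsRing R_CompleteNormedModule) with (b := fun k => (/ 4) ^ k).
    + intros k. unfold norm. simpl. unfold abs. simpl.
      rewrite Rabs_pos_eq by (apply cond_pos_sum; intros; apply Rabs_pos).
      rewrite (sum_eq _ (fun i => Rabs (vcoef n k i * x ^ i * y ^ (k - i)))).
      2:{ intros i Hi. now replace (i + (k - i))%nat with k by lia. }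
      eapply Rle_trans; [apply hom_bound_abs; apply Rlt_le; eassumption|].
      rewrite <- Hg, Rpow_mult_distr. apply Rmult_le_compat_r; [apply pow_le; lra|].
      now apply vcoef_growth.
    + apply ex_series_geom. rewrite Rabs_pos_eq; lra.
  - apply is_series_ext with (vhom n x y).
    { intros k. apply sum_eq. intros i Hi. now replace (i + (k - i))%nat with k by lia. }
    apply Series_correct, geom_dominated_ex with (/ 4); [lra|].
    intros k. rewrite <- Hg. apply vhom_bound; lra.
Qed.

Lemma vser_bound (n x y : R) : 0 < n < 3 / 2 ->
  Rabs x <= rho n -> Rabs y <= rho n -> Rabs (vser n x y) <= 1 / 2.
Proof.
  intros Hn Hx Hy.
  assert (H := geom_dominated_tail (vhom n x y) (/ 4) 0 ltac:(lra)).
  simpl sum_f_R0 in H. rewrite vhom_0, Rminus_0_r in H.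
  eapply Rle_trans; [apply H | lra].
  intros k. rewrite <- (growth_rho n Hn). now apply vhom_bound.
Qed.

Lemma vser_0 (n : R) : 0 < n < 3 / 2 -> vser n 0 0 = 0.
Proof.
  intros Hn. assert (H := geom_dominated_tail (vhom n 0 0) 0 0 ltac:(lra)).
  simpl sum_f_R0 in H. rewrite vhom_0, Rminus_0_r in H.
  apply Rabs_eq_0, Rle_antisym; [|apply Rabs_pos].
  eapply Rle_trans; [apply H | lra].
  intros k. replace (0 ^ k) with ((growth n * 0) ^ k) by (f_equal; ring).
  apply vhom_bound; [easy| |]; rewrite Rabs_R0; lra.
Qed.

(** Along the ray the series is [t * c] up to an error of at most [2 * (g * t) ^ 2], so a nonzero
    linear coefficient [c] dominates for small [t]. *)
Lemma vser_direction (n x y : R) : 0 < n < 3 / 2 ->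
  Rabs x <= 1 -> Rabs y <= 1 -> vhom n x y 1 <> 0 ->
  forall r, 0 < r -> exists t, 0 < t < r /\ vser n (t * x) (t * y) <> 0.
Proof.
  intros Hn Hx Hy Hc r Hr.
  assert (HB := growth_ge1 n Hn). set (g := growth n) in *. set (c := vhom n x y 1) in *.
  assert (Hc' : 0 < Rabs c) by now apply Rabs_pos_lt.
  (* The three bounds give [t < r], the ratio [g * t <= 1 / 2] for the tail estimate, and
     [2 * g ^ 2 * t <= Rabs c / 2], which makes the error smaller than the linear term. *)
  set (t := Rmin (r / 2) (Rmin (/ (2 * g)) (Rabs c / (4 * g ^ 2)))).
  assert (H1 : 0 < / (2 * g)) by (apply Rinv_0_lt_compat; lra).
  assert (H2 : 0 < Rabs c / (4 * g ^ 2)) by (apply Rdiv_lt_0_compat; nra).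
  assert (Ht : 0 < t) by (repeat apply Rmin_glb_lt; lra).
  assert (T1 : t <= r / 2) by apply Rmin_l.
  assert (T2 : t <= / (2 * g)) by (eapply Rle_trans; [apply Rmin_r | apply Rmin_l]).
  assert (T3 : t <= Rabs c / (4 * g ^ 2)) by (eapply Rle_trans; [apply Rmin_r | apply Rmin_r]).
  exists t. split; [lra|]. intros H0.
  assert (Q : g * t <= 1 / 2).
  { apply Rle_trans with (g * / (2 * g)); [apply Rmult_le_compat_l; lra|]. right. field. lra. }
  assert (H := geom_dominated_tail (vhom n (t * x) (t * y)) (g * t) 1 ltac:(nra)).
  fold (vser n (t * x) (t * y)) in H. rewrite H0 in H.
  simpl sum_f_R0 in H. rewrite vhom_0 in H.
  assert (E : vhom n (t * x) (t * y) 1 = t * c) by (unfold vhom; rewrite hom_scal, pow_1; easy).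
  rewrite E in H.
  replace (0 - (0 + t * c)) with (- (t * c)) in H by ring.
  rewrite Rabs_Ropp, Rabs_mult, (Rabs_pos_eq t) in H by lra.
  assert (H' : t * Rabs c <= 2 * (g * t) ^ 2).
  { apply H. intros k. apply vhom_bound; [easy| |]; rewrite Rabs_mult, (Rabs_pos_eq t) by lra; nra. }
  apply Rle_div_r in T3; [|nra].
  assert (t * (2 * g ^ 2 * t - Rabs c) >= 0) by nra.
  assert (2 * g ^ 2 * t - Rabs c < 0) by nra. nra.
Qed.

(** The linear part of [v] is [x1 / indicial (beta + 1) - x2 / indicial beta], with both
    coefficients nonzero. *)
Lemma vhom_1_fst (n : R) : 0 < n < 3 / 2 -> vhom n 1 0 1 <> 0.
Proof.
  intros Hn. assert (Hb := beta_pos n Hn).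
  unfold vhom, hom. simpl. unfold vstep, ucoef, PS_mult. simpl.
  match goal with |- ?z <> 0 => replace z with (/ indicial (beta n + 1)) end.
  - apply Rinv_neq_0_compat, Rgt_not_eq, indicial_pos. lra.
  - rewrite !Rmult_1_r. unfold Rdiv. ring.
Qed.

Lemma vhom_1_snd (n : R) : 0 < n < 3 / 2 -> vhom n 0 1 1 <> 0.
Proof.
  intros Hn. assert (Hb := beta_pos n Hn).
  unfold vhom, hom. simpl. unfold vstep, ucoef, PS_mult. simpl.
  match goal with |- ?z <> 0 => replace z with (- / indicial (beta n)) end.
  - apply Ropp_neq_0_compat, Rinv_neq_0_compat, Rgt_not_eq, indicial_pos. lra.
  - rewrite !Rmult_1_r, Rplus_0_r. unfold Rdiv. ring.
Qed.

Lemma vser_depends_on_fst (n : R) : 0 < n < 3 / 2 -> depends_on_fst (vser n).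
Proof.
  intros Hn r Hr.
  destruct (vser_direction n 1 0 Hn) with (r := r) as (t & Ht & H); try easy.
  1,2: rewrite Rabs_pos_eq; lra.
  { now apply vhom_1_fst. }
  exists t, 0, 0. rewrite Rabs_R0, Rabs_pos_eq, vser_0 by (easy || lra).
  rewrite Rmult_1_r, Rmult_0_r in H. repeat split; easy.
Qed.

Lemma vser_depends_on_snd (n : R) : 0 < n < 3 / 2 -> depends_on_snd (vser n).
Proof.
  intros Hn r Hr.
  destruct (vser_direction n 0 1 Hn) with (r := r) as (t & Ht & H); try easy.
  1,2: rewrite Rabs_pos_eq; lra.
  { now apply vhom_1_snd. }
  exists 0, t, 0. rewrite Rabs_R0, Rabs_pos_eq, vser_0 by (easy || lra).
  rewrite Rmult_1_r, Rmult_0_r in H. repeat split; easy.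
Qed.

Lemma depends_on_fst_nonzero (f : R -> R -> R) :
  depends_on_fst f -> not_identically_zero f.
Proof.
  intros H r Hr. destruct (H r Hr) as (x & x' & y & Hx & Hx' & Hy & Hf).
  destruct (Req_dec (f x y) 0) as [E|E].
  - exists x', y. repeat split; try easy. congruence.
  - now exists x, y.
Qed.

(** * Identification of the series of [uhom] with the power of [1 + v] *)

Lemma uhom_vhom_ode (n x y : R) (m : nat) :
  PS_plus (PS_derive (uhom n x y)) (PS_mult (vhom n x y) (PS_derive (uhom n x y))) m =
  PS_scal (1 - n) (PS_mult (PS_derive (vhom n x y)) (uhom n x y)) m.
Proof.
  unfold PS_plus, PS_scal, PS_mult, PS_derive. change plus with Rplus. change scal with Rmult.
  set (u := uhom n x y). set (v := vhom n x y).
  (* Miller's recurrence with its denominator cleared: the coefficient of [t ^ m] in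
     [U' = (1 - n) V' U - V U']. *)
  assert (E : INR (S m) * u (S m) =
    sum_f_R0 (fun j => ((1 - n) * INR (S j) - INR (m - j)) * (v (S j) * u (m - j)%nat)) m).
  { unfold u at 1. rewrite uhom_S, scal_sum. apply sum_eq. intros j _.
    fold u v. unfold miller. field. apply not_0_INR. lia. }
  rewrite E.
  (* Index shift [k = S j]: the term lost at the start contains [v 0 = 0], the one gained at the end
     the factor [INR 0]. *)
  replace (sum_f_R0 (fun k => v k * (INR (S (m - k)) * u (S (m - k)))) m)
    with (sum_f_R0 (fun j => INR (m - j) * (v (S j) * u (m - j)%nat)) m).
  - rewrite <- plus_sum, scal_sum. apply sum_eq. intros j _. ring.
  - destruct m as [|m].
    + simpl. unfold v. rewrite vhom_0. ring.
    + rewrite tech5, Nat.sub_diag. change (INR 0) with 0.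
      rewrite (decomp_sum (fun k => v k * _)) by lia.
      unfold v at 3. rewrite vhom_0. simpl pred.
      rewrite !Rmult_0_l, Rplus_0_l, Rplus_0_r.
      apply sum_eq. intros j Hj.
      replace (S m - j)%nat with (S (S m - S j)) by lia. ring.
Qed.

(** A radius beyond 1 puts the whole segment [0 <= t <= 1] of a ray, endpoint included, inside the
    open disc where the series can be differentiated. *)
Lemma CV_radius_ge2 (a : nat -> R) :
  (forall k, Rabs (a k) <= (/ 4) ^ k) -> Rbar_le 2 (CV_radius a).
Proof.
  intros Ha. apply (proj1 (CV_radius_bounded a)). exists 1. intros k.
  rewrite Rabs_mult, (Rabs_pos_eq (2 ^ k)) by (apply pow_le; lra).
  apply Rle_trans with ((/ 4) ^ k * 2 ^ k).
  - apply Rmult_le_compat_r; [apply pow_le; lra | apply Ha].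
  - rewrite <- Rpow_mult_distr. rewrite <- (pow1 k). apply pow_incr. lra.
Qed.

Lemma is_derive_Rpower_comp (f : R -> R) (x df a : R) :
  0 < f x -> is_derive f x df ->
  is_derive (fun t => Rpower (f t) a) x (a * Rpower (f x) (a - 1) * df).
Proof.
  intros H Hf. rewrite Rmult_comm.
  apply (is_derive_comp (fun s => Rpower s a) f x); [|exact Hf].
  now apply is_derive_Reals, derivable_pt_lim_power.
Qed.

(* Along a ray, [U' (1 + V) = (1 - n) V' U], so [U (1 + V) ^ (n - 1)] is constant. *)
Lemma Series_uhom (n x y : R) : 0 < n < 3 / 2 ->
  Rabs x <= rho n -> Rabs y <= rho n ->
  Series (uhom n x y) = Rpower (1 + vser n x y) (1 - n).
Proof.
  intros Hn Hx Hy.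
  assert (Hu : Rbar_le 2 (CV_radius (uhom n x y))).
  { apply CV_radius_ge2. intros k. rewrite <- (growth_rho n Hn). now apply uhom_bound. }
  assert (Hv : Rbar_le 2 (CV_radius (vhom n x y))).
  { apply CV_radius_ge2. intros k. rewrite <- (growth_rho n Hn). now apply vhom_bound. }
  set (U := PSeries (uhom n x y)). set (V := PSeries (vhom n x y)).
  assert (HV : forall t, V t = vser n (t * x) (t * y)).
  { intros t. apply Series_ext. intros k. unfold vhom. rewrite hom_scal. ring. }
  assert (HVb : forall t, 0 <= t <= 1 -> 0 < 1 + V t).
  { intros t Ht. assert (H := vser_bound n (t * x) (t * y) Hn).
    rewrite HV. enough (Rabs (vser n (t * x) (t * y)) <= 1 / 2) by (apply Rabs_le_between in H0; lra).
    assert (Rabs x >= 0) by (apply Rle_ge, Rabs_pos).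
    assert (Rabs y >= 0) by (apply Rle_ge, Rabs_pos).
    apply H; rewrite Rabs_mult, (Rabs_pos_eq t) by lra; nra. }
  set (G := fun t => U t * Rpower (1 + V t) (n - 1)).
  assert (HG : forall t, 0 <= t <= 1 -> is_derive G t 0).
  { intros t Ht.
    assert (Tu : Rbar_lt (Rabs t) (CV_radius (uhom n x y))).
    { eapply Rbar_lt_le_trans; [|exact Hu]. simpl. rewrite Rabs_pos_eq; lra. }
    assert (Tv : Rbar_lt (Rabs t) (CV_radius (vhom n x y))).
    { eapply Rbar_lt_le_trans; [|exact Hv]. simpl. rewrite Rabs_pos_eq; lra. }
    set (U' := PSeries (PS_derive (uhom n x y)) t).
    set (V' := PSeries (PS_derive (vhom n x y)) t).
    assert (E : U' + V t * U' = (1 - n) * (V' * U t)).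
    { unfold U', V', U, V.
      rewrite <- !PSeries_mult, <- PSeries_scal, <- PSeries_plus;
        try (rewrite ?CV_radius_derive; assumption).
      - apply PSeries_ext. intros m. apply uhom_vhom_ode.
      - apply ex_pseries_derive, Tu.
      - eexists. apply is_pseries_mult; try (rewrite ?CV_radius_derive; assumption).
        + apply PSeries_correct, CV_disk_correct, CV_disk_inside, Tv.
        + apply PSeries_correct, ex_pseries_derive, Tu. }
    assert (D : is_derive G t (U' * Rpower (1 + V t) (n - 1) +
        U t * ((n - 1) * Rpower (1 + V t) (n - 1 - 1) * (0 + V')))).
    { apply (Derive.is_derive_mult U (fun t => Rpower (1 + V t) (n - 1))).
      - now apply is_derive_PSeries.
      - apply (is_derive_Rpower_comp (fun t => 1 + V t)); [now apply HVb|].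
        apply (@is_derive_plus R_AbsRing R_NormedModule).
        + apply (@is_derive_const R_AbsRing R_NormedModule).
        + now apply is_derive_PSeries. }
    replace 0 with (U' * Rpower (1 + V t) (n - 1) +
        U t * ((n - 1) * Rpower (1 + V t) (n - 1 - 1) * (0 + V'))); [exact D|].
    (* With [(1 + V t) ^ (n - 2)] factored out, the derivative of [G] is a multiple of the
       difference of the two sides of [E]. *)
    replace (n - 1) with (n - 1 - 1 + 1) at 1 by ring.
    rewrite Rpower_plus, Rpower_1 by now apply HVb.
    set (p := Rpower (1 + V t) (n - 1 - 1)).
    replace (U' * (p * (1 + V t)) + U t * ((n - 1) * p * (0 + V')))
      with (p * (U' + V t * U' - (1 - n) * (V' * U t))) by ring.
    rewrite E. ring. }
  destruct (MVT_gen G 0 1 (fun _ => 0)) as (c & _ & Hc).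
  - intros t. rewrite Rmin_left, Rmax_right by lra. intros Ht. apply HG. lra.
  - intros t. rewrite Rmin_left, Rmax_right by lra. intros Ht.
    apply continuity_pt_filterlim, (@ex_derive_continuous R_AbsRing R_NormedModule).
    exists 0. now apply HG.
  - assert (H1 : G 1 = 1).
    { replace (G 1) with (G 0) by lra. unfold G, U, V.
      rewrite !PSeries_0, uhom_0, vhom_0, Rplus_0_r. unfold Rpower. rewrite ln_1, Rmult_0_r, exp_0. ring. }
    assert (EU : U 1 = Series (uhom n x y)).
    { apply Series_ext. intros k. rewrite pow1. ring. }
    assert (EV : V 1 = vser n x y) by (rewrite HV, !Rmult_1_l; easy).
    unfold G in H1. rewrite EU, EV in H1.
    replace (1 - n) with (- (n - 1)) by ring. rewrite Rpower_Ropp.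
    apply Rmult_eq_reg_r with (Rpower (1 + vser n x y) (n - 1)).
    + rewrite H1, Rinv_l; [easy|]. apply Rgt_not_eq, exp_pos.
    + apply Rgt_not_eq, exp_pos.
Qed.

(** * Third-order estimates at the origin *)

Lemma mvt (f df : R -> R) (a b : R) : a < b ->
  (forall x, a <= x <= b -> is_derive f x (df x)) ->
  exists c, a <= c <= b /\ f b - f a = df c * (b - a).
Proof.
  intros Hab Hf. destruct (MVT_gen f a b df) as (c & Hc & E).
  - rewrite Rmin_left, Rmax_right by lra. intros x Hx. apply Hf. lra.
  - rewrite Rmin_left, Rmax_right by lra. intros x Hx.
    apply continuity_pt_filterlim, (@ex_derive_continuous R_AbsRing R_NormedModule).
    eexists. now apply Hf.
  - rewrite Rmin_left, Rmax_right in Hc by lra. now exists c.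
Qed.

Lemma increasing_of_derive (f df : R -> R) (a b : R) : a <= b ->
  (forall x, a <= x <= b -> is_derive f x (df x)) ->
  (forall x, a <= x <= b -> 0 <= df x) -> f a <= f b.
Proof.
  intros [Hab|<-] Hf Hd; [|lra].
  destruct (mvt f df a b Hab Hf) as (c & Hc & E). specialize (Hd c Hc). nra.
Qed.

Definition derive_on (f df : R -> R) (d : R) : Prop :=
  forall x, 0 < x < d -> is_derive f x (df x).

(** The case [m = 0] serves as convergence to 0 from the right. *)
Definition little_o (m : nat) (f : R -> R) : Prop :=
  forall eps, 0 < eps -> exists d, 0 < d /\ forall x, 0 < x < d -> Rabs (f x) <= eps * x ^ m.

(* The secant of [f] over [z, y] has slope at least [- 3 eps] when [f = o(x)]
   and [z <= y / 2], and secant slopes increase. *)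
Lemma convex_little_o_nonneg (f f1 f2 : R -> R) (d : R) :
  derive_on f f1 d -> derive_on f1 f2 d -> (forall x, 0 < x < d -> 0 <= f2 x) ->
  little_o 1 f -> forall x, 0 < x < d -> 0 <= f x.
Proof.
  intros H1 H2 Hp Ho x Hx.
  destruct (Rle_lt_dec 0 (f x)) as [H|H]; [easy|exfalso].
  (* With [f x = - 4 * eps * x], slopes of at least [- 3 * eps] on [[y, x]] give [f x >= - eps * y -
     3 * eps * (x - y) > - 4 * eps * x], a contradiction. *)
  assert (He : 0 < - f x / (4 * x)) by (apply Rdiv_lt_0_compat; lra).
  destruct (Ho _ He) as (e & Hepos & Hb). set (eps := - f x / (4 * x)) in *.
  set (y := Rmin (x / 2) (e / 2)). set (z := y / 2).
  assert (Hy : 0 < y) by (apply Rmin_glb_lt; lra).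
  assert (Hyx : y <= x / 2) by apply Rmin_l.
  assert (Hye : y <= e / 2) by apply Rmin_r.
  assert (By := Hb y ltac:(lra)). assert (Bz := Hb z ltac:(unfold z; lra)).
  rewrite pow_1 in By, Bz. apply Rabs_le_between in By, Bz.
  destruct (mvt f f1 z y) as (c1 & Hc1 & E1).
  { unfold z; lra. } { intros t Ht. apply H1. unfold z in Ht; lra. }
  destruct (mvt f f1 y x) as (c2 & Hc2 & E2).
  { lra. } { intros t Ht. apply H1. lra. }
  assert (Hinc : f1 c1 <= f1 c2).
  { apply increasing_of_derive with f2; [lra| |]; intros t Ht;
      [apply H2 | apply Hp]; unfold z in Hc1; lra. }
  assert (S1 : - (3 * eps) <= f1 c1).
  { unfold z in *. nra. }
  assert (S2 : - (3 * eps) * (x - y) <= f x - f y) by nra.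
  assert (E : eps * (4 * x) = - f x) by (unfold eps; field; lra).
  nra.
Qed.

(** If [g2] had a value [c > 0] at [x0], then [g2 >= c] on [(0, x0)] because [g3 <= 0]; so
    [g - c / 2 * x ^ 2] would be convex and [o(x)], hence nonnegative, against [g = o(x ^ 2)]. Thus
    [g2 <= 0], and the convex function [- g], being [o(x)], is nonnegative. *)
Lemma little_o_nonpos (g g1 g2 g3 : R -> R) (d : R) :
  derive_on g g1 d -> derive_on g1 g2 d -> derive_on g2 g3 d ->
  (forall x, 0 < x < d -> g3 x <= 0) -> little_o 2 g ->
  forall x, 0 < x < d -> g x <= 0.
Proof.
  intros H1 H2 H3 Hn Ho.
  assert (Hpow : forall x, 0 < x < 1 -> x ^ 2 <= x ^ 1) by (intros; nra).
  assert (Hneg : forall x, 0 < x < d -> g2 x <= 0).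
  { intros x0 Hx0. destruct (Rle_lt_dec (g2 x0) 0) as [H|H]; [easy|exfalso].
    set (c := g2 x0) in *.
    assert (Hdec : forall x, 0 < x < x0 -> c <= g2 x).
    { intros x Hx. apply Ropp_le_cancel.
      apply (increasing_of_derive (fun t => - g2 t) (fun t => - g3 t)); [lra| |].
      - intros t Ht. apply (@is_derive_opp R_AbsRing R_NormedModule), H3. lra.
      - intros t Ht. assert (H' := Hn t ltac:(lra)). lra. }
    assert (Hc : forall x, 0 < x < x0 -> 0 <= g x - c / 2 * x ^ 2).
    { apply (convex_little_o_nonneg _ (fun x => g1 x - c * x) (fun x => g2 x - c)).
      - intros x Hx. apply (@is_derive_minus R_AbsRing R_NormedModule); [apply H1; lra|].
        auto_derive; [easy | field].
      - intros x Hx. apply (@is_derive_minus R_AbsRing R_NormedModule); [apply H2; lra|].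
        auto_derive; [easy | ring].
      - intros x Hx. specialize (Hdec x Hx). lra.
      - intros eps He. destruct (Ho (eps / 2)) as (e & Hep & Hb); [lra|].
        assert (0 < eps / c) by now apply Rdiv_lt_0_compat.
        exists (Rmin (Rmin e 1) (eps / c)). split; [repeat apply Rmin_glb_lt; lra|].
        intros x [Hx Hx']. assert (B1 := Rmin_l (Rmin e 1) (eps / c)).
        assert (B2 := Rmin_r (Rmin e 1) (eps / c)). assert (B3 := Rmin_l e 1).
        assert (B4 := Rmin_r e 1).
        assert (B := Hb x ltac:(lra)). assert (P := Hpow x ltac:(lra)).
        assert (Q : x * c <= eps) by (apply Rle_div_r; lra).
        apply Rabs_le_between in B. apply Rabs_le. nra. }
    destruct (Ho (c / 4)) as (e & Hep & Hb); [lra|].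
    set (x := Rmin (e / 2) (x0 / 2)).
    assert (Hx : 0 < x) by (apply Rmin_glb_lt; lra).
    assert (B1 : x <= e / 2) by apply Rmin_l. assert (B2 : x <= x0 / 2) by apply Rmin_r.
    assert (B := Hb x ltac:(lra)). assert (C := Hc x ltac:(lra)).
    apply Rabs_le_between in B. assert (0 < x ^ 2) by now apply pow_lt. nra. }
  intros x Hx. apply Ropp_le_cancel. rewrite Ropp_0.
  revert x Hx. apply (convex_little_o_nonneg _ (fun x => - g1 x) (fun x => - g2 x)).
  - intros x Hx. now apply (@is_derive_opp R_AbsRing R_NormedModule), H1.
  - intros x Hx. now apply (@is_derive_opp R_AbsRing R_NormedModule), H2.
  - intros x Hx. specialize (Hneg x Hx). lra.
  - intros eps He. destruct (Ho eps He) as (e & Hep & Hb).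
    exists (Rmin e 1). split; [apply Rmin_glb_lt; lra|].
    intros x [Hx Hx']. assert (B1 := Rmin_l e 1). assert (B2 := Rmin_r e 1).
    rewrite Rabs_Ropp. eapply Rle_trans; [apply Hb; lra|].
    apply Rmult_le_compat_l; [lra|]. apply Hpow. lra.
Qed.

Lemma Rpower_pos (x a : R) : 0 < Rpower x a.
Proof. apply exp_pos. Qed.

Lemma Rpower_small (b eps : R) : 0 < b -> 0 < eps ->
  exists d, 0 < d /\ forall x, 0 < x < d -> Rpower x b <= eps.
Proof.
  intros Hb He. exists (Rpower eps (/ b)). split; [apply Rpower_pos|].
  intros x Hx. apply Rle_trans with (Rpower (Rpower eps (/ b)) b).
  - apply Rle_Rpower_l; lra.
  - rewrite Rpower_mult, Rinv_l, Rpower_1; lra.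
Qed.

Lemma is_derive_Rpower (c a x : R) : 0 < x ->
  is_derive (fun t => c * Rpower t a) x (c * a * Rpower x (a - 1)).
Proof.
  intros H. rewrite Rmult_assoc. apply is_derive_scal.
  now apply is_derive_Reals, derivable_pt_lim_power.
Qed.

Lemma Rpower_plus_nat (x a : R) (m : nat) : 0 < x -> Rpower x (a + INR m) = x ^ m * Rpower x a.
Proof. intros H. rewrite Rpower_plus, Rpower_pow by easy. ring. Qed.

(** [K / indicial b * x ^ (b + 2)] has third derivative [K * x ^ (b - 1)] and is itself [o(x ^ 2)],
    so [little_o_nonpos] applies to the difference. *)
Lemma third_derivative_upper (f f1 f2 f3 : R -> R) (d K b : R) : 0 < b -> 0 <= K ->
  derive_on f f1 d -> derive_on f1 f2 d -> derive_on f2 f3 d -> little_o 2 f ->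
  (forall x, 0 < x < d -> f3 x <= K * Rpower x (b - 1)) ->
  forall x, 0 < x < d -> f x <= K / indicial b * x ^ 2 * Rpower x b.
Proof.
  intros Hb HK H1 H2 H3 Ho Hf x Hx.
  assert (Hi := indicial_pos b Hb). set (c := K / indicial b).
  assert (Hc : 0 <= c) by (apply Rdiv_le_0_compat; lra).
  assert (E : c * (b + 2) * (b + 1) * b = K) by (unfold c, indicial; field; lra).
  enough (H : f x - c * Rpower x (b + 2) <= 0).
  { replace (b + 2) with (b + INR 2) in H by (simpl; ring).
    rewrite Rpower_plus_nat in H by lra. lra. }
  revert x Hx.
  apply (little_o_nonpos _ (fun x => f1 x - c * (b + 2) * Rpower x (b + 1))
           (fun x => f2 x - c * (b + 2) * (b + 1) * Rpower x b)
           (fun x => f3 x - K * Rpower x (b - 1))).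
  - intros x Hx. apply (@is_derive_minus R_AbsRing R_NormedModule); [now apply H1|].
    replace (b + 1) with (b + 2 - 1) by ring. now apply is_derive_Rpower.
  - intros x Hx. apply (@is_derive_minus R_AbsRing R_NormedModule); [now apply H2|].
    replace (Rpower x b) with (Rpower x (b + 1 - 1)) by (f_equal; ring).
    now apply is_derive_Rpower.
  - intros x Hx. apply (@is_derive_minus R_AbsRing R_NormedModule); [now apply H3|].
    rewrite <- E. now apply is_derive_Rpower.
  - intros x Hx. specialize (Hf x Hx). lra.
  - intros eps He. destruct (Ho (eps / 2)) as (e & Hep & Hbd); [lra|].
    destruct (Rpower_small b (eps / (2 * (c + 1)))) as (e' & Hep' & Hbd'); [easy|
      apply Rdiv_lt_0_compat; lra|].
    exists (Rmin e e'). split; [apply Rmin_glb_lt; lra|].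
    intros x [Hx Hx']. assert (B1 := Rmin_l e e'). assert (B2 := Rmin_r e e').
    specialize (Hbd x ltac:(lra)). specialize (Hbd' x ltac:(lra)).
    replace (b + 2) with (b + INR 2) by (simpl; ring). rewrite Rpower_plus_nat by lra.
    apply Rle_div_r in Hbd'; [|lra]. assert (P := Rpower_pos x b).
    assert (S : 0 < x ^ 2) by (apply pow_lt; lra).
    assert (c * Rpower x b <= eps / 2) by lra.
    assert (0 <= c * (x ^ 2 * Rpower x b)) by (apply Rmult_le_pos; [lra | nra]).
    assert (c * (x ^ 2 * Rpower x b) <= eps / 2 * x ^ 2).
    { replace (c * (x ^ 2 * Rpower x b)) with (c * Rpower x b * x ^ 2) by ring.
      apply Rmult_le_compat_r; lra. }
    apply Rabs_le_between in Hbd. apply Rabs_le. lra.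
Qed.

Lemma third_derivative_bound (f f1 f2 f3 : R -> R) (d K b : R) : 0 < b -> 0 <= K ->
  derive_on f f1 d -> derive_on f1 f2 d -> derive_on f2 f3 d -> little_o 2 f ->
  (forall x, 0 < x < d -> Rabs (f3 x) <= K * Rpower x (b - 1)) ->
  forall x, 0 < x < d -> Rabs (f x) <= K / indicial b * x ^ 2 * Rpower x b.
Proof.
  intros Hb HK H1 H2 H3 Ho Hf x Hx.
  apply Rabs_le. split.
  - apply Ropp_le_cancel. rewrite Ropp_involutive. revert x Hx.
    apply (third_derivative_upper _ (fun x => - f1 x) (fun x => - f2 x) (fun x => - f3 x));
      try assumption.
    1-3: intros x Hx; apply (@is_derive_opp R_AbsRing R_NormedModule); auto.
    + intros eps He. destruct (Ho eps He) as (e & Hep & Hbd). exists e.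
      split; [easy|]. intros x Hx. rewrite Rabs_Ropp. auto.
    + intros x Hx. specialize (Hf x Hx). apply Rabs_le_between in Hf. lra.
  - revert x Hx. apply (third_derivative_upper _ f1 f2 f3); try assumption.
    intros x Hx. specialize (Hf x Hx). apply Rabs_le_between in Hf. lra.
Qed.

(** * Local solutions *)

(** The intermediate derivatives are hidden by quantifiers, so that sums and extensionality involve
    only a function and its third derivative. *)
Definition third_derive_on (f f3 : R -> R) (d : R) : Prop :=
  exists f1 f2, derive_on f f1 d /\ derive_on f1 f2 d /\ derive_on f2 f3 d.

Lemma derive_on_plus (f g f' g' : R -> R) (d : R) :
  derive_on f f' d -> derive_on g g' d ->
  derive_on (fun x => f x + g x) (fun x => f' x + g' x) d.
Proof. intros Hf Hg x Hx. apply (@is_derive_plus R_AbsRing R_NormedModule); auto. Qed.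

Lemma derive_on_minus (f g f' g' : R -> R) (d : R) :
  derive_on f f' d -> derive_on g g' d ->
  derive_on (fun x => f x - g x) (fun x => f' x - g' x) d.
Proof. intros Hf Hg x Hx. apply (@is_derive_minus R_AbsRing R_NormedModule); auto. Qed.

Lemma derive_on_ext (f g f' g' : R -> R) (d : R) :
  (forall x, 0 < x < d -> f x = g x) -> (forall x, 0 < x < d -> f' x = g' x) ->
  derive_on f f' d -> derive_on g g' d.
Proof.
  intros E E' H x Hx. rewrite <- E' by easy.
  apply (is_derive_ext_loc f); [|now apply H].
  apply (locally_interval _ x 0 d); [easy | easy |]. intros y Hy Hy'. apply E. now split.
Qed.

Lemma third_derive_on_plus (f g f3 g3 : R -> R) (d : R) :
  third_derive_on f f3 d -> third_derive_on g g3 d ->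
  third_derive_on (fun x => f x + g x) (fun x => f3 x + g3 x) d.
Proof.
  intros (f1 & f2 & A1 & A2 & A3) (g1 & g2 & B1 & B2 & B3).
  exists (fun x => f1 x + g1 x), (fun x => f2 x + g2 x). auto using derive_on_plus.
Qed.

Lemma third_derive_on_minus (f g f3 g3 : R -> R) (d : R) :
  third_derive_on f f3 d -> third_derive_on g g3 d ->
  third_derive_on (fun x => f x - g x) (fun x => f3 x - g3 x) d.
Proof.
  intros (f1 & f2 & A1 & A2 & A3) (g1 & g2 & B1 & B2 & B3).
  exists (fun x => f1 x - g1 x), (fun x => f2 x - g2 x). auto using derive_on_minus.
Qed.

Lemma third_derive_on_ext (f g f3 g3 : R -> R) (d : R) :
  (forall x, 0 < x < d -> f x = g x) -> (forall x, 0 < x < d -> f3 x = g3 x) ->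
  third_derive_on f f3 d -> third_derive_on g g3 d.
Proof.
  intros E E' (f1 & f2 & A1 & A2 & A3). exists f1, f2.
  split; [|split]; [now apply derive_on_ext with f f1 | easy | now apply derive_on_ext with f2 f3].
Qed.

Lemma third_derive_on_restrict (f f3 : R -> R) (d d' : R) : d' <= d ->
  third_derive_on f f3 d -> third_derive_on f f3 d'.
Proof.
  intros Hd (f1 & f2 & A1 & A2 & A3). exists f1, f2.
  split; [|split]; intros x Hx; [apply A1 | apply A2 | apply A3]; lra.
Qed.

Lemma third_derive_on_sum (f f3 : nat -> R -> R) (N : nat) (d : R) :
  (forall k, third_derive_on (f k) (f3 k) d) ->
  third_derive_on (fun x => sum_f_R0 (fun k => f k x) N) (fun x => sum_f_R0 (fun k => f3 k x) N) d.
Proof.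
  intros H. induction N as [|N IH]; simpl; [apply H|].
  now apply (third_derive_on_plus _ (f (S N)) _ (f3 (S N))).
Qed.

Lemma third_derive_on_Rpower (c s d : R) :
  third_derive_on (fun x => c * Rpower x (s + 2)) (fun x => c * indicial s * Rpower x (s - 1)) d.
Proof.
  exists (fun x => c * (s + 2) * Rpower x (s + 1)), (fun x => c * (s + 2) * (s + 1) * Rpower x s).
  split; [|split]; intros x Hx.
  - replace (s + 1) with (s + 2 - 1) by ring. now apply is_derive_Rpower.
  - replace (Rpower x s) with (Rpower x (s + 1 - 1)) by (f_equal; ring). now apply is_derive_Rpower.
  - replace (c * indicial s) with (c * (s + 2) * (s + 1) * s) by (unfold indicial; ring).
    now apply is_derive_Rpower.
Qed.

(** For [x > 0] this is the second argument of [v] in [expansion], and [var1] the first. [Rpower]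
    agrees there with [rpow] and is easier to differentiate. *)
Definition var2 (n kappa x : R) : R := Rpower kappa (- n) * Rpower x (beta n).
Definition var1 (n kappa x : R) : R := x * var2 n kappa x.

Lemma var2_pos (n kappa x : R) : 0 < var2 n kappa x.
Proof. apply Rmult_lt_0_compat; apply Rpower_pos. Qed.

Lemma var_monomial (n kappa x : R) (k i : nat) : 0 < x -> (i <= k)%nat ->
  var1 n kappa x ^ i * var2 n kappa x ^ (k - i) =
  Rpower kappa (- n) ^ k * Rpower x (beta n * INR k + INR i).
Proof.
  intros Hx Hi. rewrite Rpower_plus_nat, <- Rpower_mult, Rpower_pow by (easy || apply Rpower_pos).
  unfold var1. rewrite Rpow_mult_distr, Rmult_assoc, <- pow_add.
  replace (i + (k - i))%nat with k by lia.
  unfold var2. rewrite Rpow_mult_distr. ring.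
Qed.

(** Each monomial times [x ^ 2] is a multiple of [x ^ (s + 2)] with [s] its eigenvalue under [D];
    the factor [indicial s] from differentiation cancels the denominator in [vstep] and leaves a
    monomial of [(x1 - x2) * u_k]. *)
Lemma third_derive_vhom (n kappa d : R) (k : nat) : 0 < n < 3 / 2 ->
  third_derive_on
    (fun x => kappa * x ^ 2 * vhom n (var1 n kappa x) (var2 n kappa x) (S k))
    (fun x => kappa / x * (var1 n kappa x - var2 n kappa x)
              * uhom n (var1 n kappa x) (var2 n kappa x) k) d.
Proof.
  intros Hn. set (c := kappa * Rpower kappa (- n) ^ S k).
  set (s := fun i => beta n * INR (S k) + INR i).
  apply third_derive_on_ext with
    (fun x => sum_f_R0 (fun i => c * vcoef n (S k) i * Rpower x (s i + 2)) (S k))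
    (fun x => sum_f_R0 (fun i => c * vcoef n (S k) i * indicial (s i) * Rpower x (s i - 1)) (S k)).
  - intros x Hx. unfold vhom, hom. rewrite scal_sum. apply sum_eq. intros i Hi.
    rewrite (Rmult_assoc (vcoef n (S k) i)), var_monomial by (easy || lra).
    change 2 with (INR 2) at 1. rewrite Rpower_plus_nat by lra. unfold c, s. ring.
  - intros x Hx. rewrite Rmult_assoc, <- hom_lin_diff.
    unfold hom. rewrite scal_sum. apply sum_eq. intros i Hi.
    rewrite (Rmult_assoc (PS_mult _ _ i)), var_monomial by (easy || lra).
    replace (beta n * INR (S k) + INR i) with (s i - 1 + INR 1) by (unfold s; simpl INR; ring).
    rewrite Rpower_plus_nat, pow_1 by lra.
    change (vcoef n (S k)) with (vstep n k (ucoef n k)). unfold vstep. fold (s i).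
    unfold c. field. split; [lra|].
    apply Rgt_not_eq, indicial_pos. destruct (exponent_pos n k i Hn). unfold s. cbv beta. lra.
  - apply third_derive_on_sum. intros i. apply third_derive_on_Rpower.
Qed.

(** Finite sums suffice for the comparison with a solution, which avoids differentiating the
    infinite series. The factor [x1 - x2] raises degrees by one, so [v] up to degree [S N]
    corresponds to [u] up to degree [N]. *)
Lemma third_derive_partial (n kappa d : R) (N : nat) : 0 < n < 3 / 2 ->
  third_derive_on
    (fun x => kappa * x ^ 2 * (1 + sum_f_R0 (vhom n (var1 n kappa x) (var2 n kappa x)) (S N)))
    (fun x => kappa / x * (var1 n kappa x - var2 n kappa x)
              * sum_f_R0 (uhom n (var1 n kappa x) (var2 n kappa x)) N) d.
Proof.
  intros Hn. induction N as [|N IH].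
  - eapply third_derive_on_ext; [| |apply third_derive_on_plus with
      (f := fun x => kappa * x ^ 2) (f3 := fun _ => 0) (2 := third_derive_vhom n kappa d 0 Hn)].
    + intros x Hx. simpl sum_f_R0. rewrite vhom_0. ring.
    + intros x Hx. simpl. apply Rplus_0_l.
    + exists (fun x => 2 * kappa * x), (fun x => 2 * kappa).
      split; [|split]; intros y Hy; auto_derive; trivial; ring.
  - eapply third_derive_on_ext; [| |apply third_derive_on_plus with
      (1 := IH) (2 := third_derive_vhom n kappa d (S N) Hn)].
    + intros x Hx. rewrite (tech5 _ (S N)). ring.
    + intros x Hx. rewrite (tech5 _ N). ring.
Qed.

(** Mean value theorem: the derivative is [(1 - n) * t ^ (- n)], where [Rabs (1 - n) <= 1] and
    [t ^ (- n) <= 2 ^ n <= 4] for [t >= 1 / 2]. *)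
Lemma Rpower_lipschitz (n a b : R) : 0 < n < 3 / 2 ->
  1 / 2 <= a <= 3 / 2 -> 1 / 2 <= b <= 3 / 2 ->
  Rabs (Rpower a (1 - n) - Rpower b (1 - n)) <= 4 * Rabs (a - b).
Proof.
  intros Hn.
  assert (Hq : forall t, 1 / 2 <= t -> Rpower t (- n) <= 4).
  { intros t Ht. rewrite Rpower_Ropp.
    assert (H2 : Rpower 2 n <= 4).
    { replace 4 with (Rpower 2 (INR 2)) by (rewrite Rpower_pow; lra).
      apply Rle_Rpower; simpl; lra. }
    assert (E : Rpower (1 / 2) n * Rpower 2 n = 1).
    { rewrite Rpower_mult_distr by lra. replace (1 / 2 * 2) with 1 by lra.
      unfold Rpower. now rewrite ln_1, Rmult_0_r, exp_0. }
    assert (H3 : Rpower (1 / 2) n <= Rpower t n) by (apply Rle_Rpower_l; lra).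
    assert (P := Rpower_pos (1 / 2) n).
    rewrite <- (Rinv_inv 4). apply Rinv_le_contravar; nra. }
  assert (Hw : forall u w, 1 / 2 <= u -> u < w ->
    Rabs (Rpower u (1 - n) - Rpower w (1 - n)) <= 4 * Rabs (u - w)).
  { intros u w Hu Huw.
    destruct (mvt (fun t => Rpower t (1 - n)) (fun t => (1 - n) * Rpower t (1 - n - 1)) u w Huw)
      as (c & Hc & E).
    - intros t Ht. apply is_derive_Reals, derivable_pt_lim_power. lra.
    - rewrite Rabs_minus_sym, E, Rabs_mult, (Rabs_minus_sym u w).
      apply Rmult_le_compat_r; [apply Rabs_pos|].
      rewrite Rabs_mult, (Rabs_pos_eq (Rpower _ _)) by apply Rlt_le, Rpower_pos.
      replace (1 - n - 1) with (- n) by ring.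
      rewrite <- (Rmult_1_l 4). apply Rmult_le_compat; try apply Rabs_pos.
      + apply Rlt_le, Rpower_pos.
      + apply Rabs_le. lra.
      + apply Hq. lra. }
  intros Ha Hb. destruct (Rtotal_order a b) as [H|[<-|H]].
  - now apply Hw.
  - rewrite !Rminus_diag, Rabs_R0. lra.
  - rewrite (Rabs_minus_sym (Rpower _ _)), (Rabs_minus_sym a). now apply Hw.
Qed.

(** The partial sums of orders 0 and [N] both lie within [2 * (growth n * r)] of the full sum, and
    the former is 0. *)
Lemma vhom_partial_small (n x y r : R) (N : nat) : 0 < n < 3 / 2 ->
  Rabs x <= r -> Rabs y <= r -> r <= rho n ->
  Rabs (sum_f_R0 (vhom n x y) N) <= 4 * (growth n * r).
Proof.
  intros Hn Hx Hy Hr. assert (HB := growth_ge1 n Hn). assert (Hg := growth_rho n Hn).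
  assert (H0 : 0 <= r) by (eapply Rle_trans; [apply Rabs_pos | exact Hx]).
  assert (Hq : 0 <= growth n * r <= 1 / 2) by nra.
  assert (Hk : forall k, Rabs (vhom n x y k) <= (growth n * r) ^ k)
    by (intros k; now apply vhom_bound).
  assert (T1 := geom_dominated_tail _ _ 0 Hq Hk).
  assert (T2 := geom_dominated_tail _ _ N Hq Hk).
  simpl sum_f_R0 in T1 at 1. rewrite vhom_0 in T1.
  assert (P : (growth n * r) ^ S N <= growth n * r).
  { rewrite <- (Rmult_1_r (growth n * r)) at 2. simpl. apply Rmult_le_compat_l; [lra|].
    rewrite <- (pow1 N). apply pow_incr. lra. }
  rewrite pow_1 in T1. apply Rabs_le_between in T1, T2. apply Rabs_le. lra.
Qed.

Definition rel_dev (kappa : R) (h : R -> R) (x : R) : R := h x / (kappa * x ^ 2) - 1.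

Lemma rel_devE (kappa : R) (h : R -> R) (x : R) : 0 < kappa -> 0 < x ->
  h x = kappa * x ^ 2 * (1 + rel_dev kappa h x).
Proof. intros Hk Hx. unfold rel_dev. field. lra. Qed.

(** Here [kappa] is absorbed into the variables: [(kappa * x ^ 2) ^ (1 - n) = kappa / x * var2 n
    kappa x], because [beta = 2 * (1 - n) + 1]. *)
Lemma rhs_normalized (n kappa : R) (h : R -> R) (x : R) : 0 < kappa -> 0 < x -> 0 < h x ->
  (x - 1) * Rpower (h x) (1 - n) =
  kappa / x * (var1 n kappa x - var2 n kappa x) * Rpower (1 + rel_dev kappa h x) (1 - n).
Proof.
  intros Hkappa Hx Hh.
  assert (Hk2 : 0 < kappa * x ^ 2) by (apply Rmult_lt_0_compat; [easy | apply pow_lt; lra]).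
  assert (E := rel_devE kappa h x Hkappa Hx).
  set (w := rel_dev kappa h x) in *.
  assert (Hw : 0 < 1 + w) by (rewrite E in Hh; nra).
  rewrite E. rewrite <- !Rpower_mult_distr; try easy; [|apply pow_lt; lra].
  unfold var1, var2, beta.
  rewrite <- (Rpower_pow 2 x), Rpower_mult by lra.
  replace (Rpower kappa (1 - n)) with (kappa * Rpower kappa (- n)).
  2:{ replace (1 - n) with (- n + INR 1) by (simpl; ring). rewrite Rpower_plus_nat by easy. ring. }
  replace (3 - 2 * n) with (INR 2 * (1 - n) + INR 1) by (simpl; ring).
  rewrite Rpower_plus_nat by lra. field. lra.
Qed.

Lemma var_bounds (n kappa x : R) : 0 < x <= 1 ->
  Rabs (var1 n kappa x) <= var2 n kappa x /\ Rabs (var2 n kappa x) <= var2 n kappa x /\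
  Rabs (var1 n kappa x - var2 n kappa x) <= var2 n kappa x.
Proof.
  intros Hx. assert (P := var2_pos n kappa x). unfold var1.
  split; [|split]; apply Rabs_le; nra.
Qed.

Lemma var2_small (n kappa eps : R) : 0 < n < 3 / 2 -> 0 < eps ->
  exists e, 0 < e /\ forall x, 0 < x < e -> var2 n kappa x <= eps.
Proof.
  intros Hn He. assert (P := Rpower_pos kappa (- n)).
  destruct (Rpower_small (beta n) (eps / Rpower kappa (- n))) as (e & Hep & H);
    [now apply beta_pos | now apply Rdiv_lt_0_compat|].
  exists e. split; [easy|]. intros x Hx. specialize (H x Hx).
  apply Rle_div_r in H; [|easy]. unfold var2. lra.
Qed.

Lemma remainder_little_o (n kappa : R) (h : R -> R) (N : nat) : 0 < n < 3 / 2 -> 0 < kappa ->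
  little_o 0 (rel_dev kappa h) ->
  little_o 2 (fun x => h x - kappa * x ^ 2 *
    (1 + sum_f_R0 (vhom n (var1 n kappa x) (var2 n kappa x)) N)).
Proof.
  intros Hn Hk Hlim eps He. assert (HB := growth_ge1 n Hn). assert (Hr := rho_pos n Hn).
  assert (He' : 0 < eps / (2 * kappa)) by (apply Rdiv_lt_0_compat; lra).
  destruct (Hlim (eps / (2 * kappa))) as (e1 & He1 & H1); [easy|].
  destruct (var2_small n kappa (rho n) Hn Hr) as (e2 & He2 & H2).
  destruct (var2_small n kappa (eps / (2 * kappa) / (4 * growth n)) Hn) as (e3 & He3 & H3);
    [apply Rdiv_lt_0_compat; lra|].
  exists (Rmin (Rmin e1 e2) (Rmin e3 1)). split; [repeat apply Rmin_glb_lt; lra|].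
  intros x [Hx Hx']. apply Rmin_Rgt in Hx' as [Ha Hb]. apply Rmin_Rgt in Ha as [Ha1 Ha2].
  apply Rmin_Rgt in Hb as [Hb1 Hb2].
  specialize (H1 x ltac:(lra)). specialize (H2 x ltac:(lra)). specialize (H3 x ltac:(lra)).
  destruct (var_bounds n kappa x ltac:(lra)) as (V1 & V2 & _).
  assert (B := vhom_partial_small n _ _ _ N Hn V1 V2 H2).
  apply Rle_div_r in H3; [|lra]. simpl pow in H1. rewrite Rmult_1_r in H1.
  rewrite (rel_devE kappa h x Hk Hx) at 1.
  set (V := sum_f_R0 _ _) in *. set (w := rel_dev kappa h x) in *.
  assert (Hx2 : 0 < x ^ 2) by now apply pow_lt.
  replace (kappa * x ^ 2 * (1 + w) - kappa * x ^ 2 * (1 + V)) with (kappa * x ^ 2 * (w - V)) by ring.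
  rewrite Rabs_mult, Rabs_pos_eq by nra.
  replace (eps * x ^ 2) with (kappa * x ^ 2 * (eps / kappa)) by (field; lra).
  apply Rmult_le_compat_l; [nra|].
  apply Rle_trans with (Rabs w + Rabs V).
  - unfold Rminus. eapply Rle_trans; [apply Rabs_triang|]. rewrite Rabs_Ropp. lra.
  - replace (eps / kappa) with (eps / (2 * kappa) + eps / (2 * kappa)) by (field; lra). lra.
Qed.

Lemma pow_quarter_small (eps : R) : 0 < eps -> exists N, (/ 4) ^ N <= eps.
Proof.
  intros He. destruct (pow_lt_1_zero (/ 4)) with (y := eps) as (N & HN); [rewrite Rabs_pos_eq; lra | easy|].
  exists N. specialize (HN N (le_n N)). rewrite Rabs_pos_eq in HN; [lra|]. apply pow_le. lra.
Qed.

(** * Contraction estimate for a local solution against the series *)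

Section Contraction.

Variables (n kappa d : R) (h h3 : R -> R).
Hypothesis (Hn : 0 < n < 3 / 2) (Hkappa : 0 < kappa) (Hd : 0 < d <= 1).
Hypothesis Hh3 : third_derive_on h h3 d.
Hypothesis Hpos : forall x, 0 < x < d -> 0 < h x.
Hypothesis Hode : forall x, 0 < x < d -> h3 x = (x - 1) * Rpower (h x) (1 - n).
Hypothesis Hlim : little_o 0 (rel_dev kappa h).
Hypothesis Hw : forall x, 0 < x < d -> Rabs (rel_dev kappa h x) <= 1 / 2.
Hypothesis Hvar : forall x, 0 < x < d -> var2 n kappa x <= rho n.
Hypothesis Hsmall : forall x, 0 < x < d -> 16 * var2 n kappa x <= indicial (beta n).

Let defect (x : R) : R := rel_dev kappa h x - vser n (var1 n kappa x) (var2 n kappa x).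

(** The third derivative of [h] minus the partial sum is at most
    [kappa / x * var2 * (4 * S + (/ 4) ^ N)]: the Lipschitz constant contributes [4 * S], the tail
    of the [u] series the rest. Three integrations divide by [indicial (beta n)], and [Hsmall] turns
    [var2 / indicial (beta n)] into at most [/ 16]. *)
Lemma defect_partial (S : R) (N : nat) :
  0 <= S -> (forall x, 0 < x < d -> Rabs (defect x) <= S) ->
  forall x, 0 < x < d ->
  Rabs (rel_dev kappa h x - sum_f_R0 (vhom n (var1 n kappa x) (var2 n kappa x)) (Datatypes.S N))
    <= S / 4 + (/ 4) ^ N.
Proof.
  intros HS0 HS x Hx.
  assert (Hl := Rpower_pos kappa (- n)). assert (Hb := beta_pos n Hn).
  assert (Hi := indicial_pos _ Hb). assert (HN : 0 < (/ 4) ^ N) by (apply pow_lt; lra).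
  set (K := kappa * Rpower kappa (- n) * (4 * S + (/ 4) ^ N)).
  assert (HK : 0 <= K) by (unfold K; repeat apply Rmult_le_pos; lra).
  destruct (third_derive_on_minus _ _ _ _ d Hh3 (third_derive_partial n kappa d N Hn))
    as (f1 & f2 & F1 & F2 & F3).
  assert (B := third_derivative_bound _ f1 f2 _ d K (beta n) Hb HK F1 F2 F3
    (remainder_little_o n kappa h (Datatypes.S N) Hn Hkappa Hlim)).
  cbv beta in B.
  assert (H3 : Rabs (h x - kappa * x ^ 2 *
     (1 + sum_f_R0 (vhom n (var1 n kappa x) (var2 n kappa x)) (Datatypes.S N))) <=
     K / indicial (beta n) * x ^ 2 * Rpower x (beta n)).
  { apply B; [|easy]. clear x Hx B. intros x Hx.
    rewrite Hode, (rhs_normalized n kappa) by (try apply Hpos; easy).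
    destruct (var_bounds n kappa x ltac:(lra)) as (V1 & V2 & V3).
    assert (R1 : Rabs (var1 n kappa x) <= rho n) by (eapply Rle_trans; [exact V1 | now apply Hvar]).
    assert (R2 : Rabs (var2 n kappa x) <= rho n) by (eapply Rle_trans; [exact V2 | now apply Hvar]).
    assert (HU := Series_uhom n _ _ Hn R1 R2).
    assert (Hv := vser_bound n _ _ Hn R1 R2).
    assert (T := geom_dominated_tail (uhom n (var1 n kappa x) (var2 n kappa x)) (/ 4) N ltac:(lra)).
    rewrite HU in T. specialize (HS x Hx). unfold defect in HS. specialize (Hw x Hx).
    set (V := vser n _ _) in *. set (w := rel_dev kappa h x) in *.
    set (U := sum_f_R0 _ N) in *.
    assert (L := Rpower_lipschitz n (1 + w) (1 + V) Hn).
    apply Rabs_le_between in Hw, Hv. specialize (L ltac:(lra) ltac:(lra)).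
    replace (1 + w - (1 + V)) with (w - V) in L by ring.
    assert (T' : Rabs (Rpower (1 + V) (1 - n) - U) <= 2 * (/ 4) ^ Datatypes.S N).
    { apply T. intros k. rewrite <- (growth_rho n Hn). now apply uhom_bound. }
    simpl pow in T'.
    rewrite <- Rmult_minus_distr_l, Rabs_mult.
    replace (K * Rpower x (beta n - 1))
      with (kappa / x * var2 n kappa x * (4 * S + (/ 4) ^ N)).
    2:{ unfold K, var2. replace (beta n) with (beta n - 1 + INR 1) at 1 by (simpl; ring).
        rewrite Rpower_plus_nat by easy. field. lra. }
    apply Rmult_le_compat; try apply Rabs_pos.
    - assert (0 < kappa / x) by (apply Rdiv_lt_0_compat; easy).
      rewrite Rabs_mult, (Rabs_pos_eq (kappa / x)) by lra.
      apply Rmult_le_compat_l; lra.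
    - replace (Rpower (1 + w) (1 - n) - U) with
        ((Rpower (1 + w) (1 - n) - Rpower (1 + V) (1 - n)) + (Rpower (1 + V) (1 - n) - U)) by ring.
      eapply Rle_trans; [apply Rabs_triang|]. lra. }
  rewrite (rel_devE kappa h x Hkappa) in H3 at 1 by easy.
  set (V := sum_f_R0 _ _) in *. set (w := rel_dev kappa h x) in *.
  assert (Hx2 : 0 < kappa * x ^ 2) by (apply Rmult_lt_0_compat; [easy | apply pow_lt; easy]).
  replace (kappa * x ^ 2 * (1 + w) - kappa * x ^ 2 * (1 + V)) with (kappa * x ^ 2 * (w - V)) in H3 by ring.
  rewrite Rabs_mult, (Rabs_pos_eq (kappa * _)) in H3 by lra.
  replace (K / indicial (beta n) * x ^ 2 * Rpower x (beta n))
    with (kappa * x ^ 2 * ((4 * S + (/ 4) ^ N) * (var2 n kappa x / indicial (beta n)))) in H3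
    by (unfold K, var2; field; lra).
  apply Rmult_le_reg_l in H3; [|easy].
  assert (Q : var2 n kappa x / indicial (beta n) <= / 16).
  { apply Rle_div_l; [easy|]. specialize (Hsmall x Hx). lra. }
  eapply Rle_trans; [exact H3|].
  apply Rle_trans with ((4 * S + (/ 4) ^ N) * / 16); [apply Rmult_le_compat_l; lra | lra].
Qed.

Lemma defect_contracts (S : R) :
  0 < S -> (forall x, 0 < x < d -> Rabs (defect x) <= S) ->
  forall x, 0 < x < d -> Rabs (defect x) <= S / 2.
Proof.
  intros HS0 HS x Hx.
  (* The three errors are then at most [S / 4], [S / 8] and, for the tail of [v], [S / 64]; together
     less than [S / 2]. *)
  destruct (pow_quarter_small (S / 8)) as (N & HN); [lra|].
  assert (B := defect_partial S N ltac:(lra) HS x Hx).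
  destruct (var_bounds n kappa x ltac:(lra)) as (V1 & V2 & _).
  assert (T := geom_dominated_tail (vhom n (var1 n kappa x) (var2 n kappa x)) (/ 4)
     (Datatypes.S N) ltac:(lra)).
  fold (vser n (var1 n kappa x) (var2 n kappa x)) in T.
  set (V := sum_f_R0 _ _) in *.
  assert (T' : Rabs (vser n (var1 n kappa x) (var2 n kappa x) - V) <= 2 * (/ 4) ^ Datatypes.S (Datatypes.S N)).
  { apply T. intros k. rewrite <- (growth_rho n Hn). apply vhom_bound; [easy| |];
      eapply Rle_trans; try eassumption; now apply Hvar. }
  simpl pow in T'. unfold defect.
  apply Rabs_le_between in B, T'. apply Rabs_le. lra.
Qed.

(** Both terms of the defect are at most [1 / 2], so the bound starts at 1; halving it repeatedly
    forces 0. *)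
Lemma defect_zero (x : R) : 0 < x < d -> defect x = 0.
Proof.
  intros Hx.
  assert (H : forall m x, 0 < x < d -> Rabs (defect x) <= (1 / 2) ^ m).
  { induction m as [|m IH]; intros y Hy.
    - destruct (var_bounds n kappa y ltac:(lra)) as (V1 & V2 & _).
      assert (Hv := vser_bound n (var1 n kappa y) (var2 n kappa y) Hn
        (Rle_trans _ _ _ V1 (Hvar y Hy)) (Rle_trans _ _ _ V2 (Hvar y Hy))).
      specialize (Hw y Hy). unfold defect. simpl.
      apply Rabs_le_between in Hw, Hv. apply Rabs_le. lra.
    - replace ((1 / 2) ^ Datatypes.S m) with ((1 / 2) ^ m / 2) by (simpl; lra).
      apply defect_contracts; [apply pow_lt; lra | exact IH | exact Hy]. }
  destruct (Req_dec (defect x) 0) as [E|E]; [easy|exfalso].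
  destruct (pow_lt_1_zero (1 / 2)) with (y := Rabs (defect x)) as (m & Hm).
  - rewrite Rabs_pos_eq; lra.
  - now apply Rabs_pos_lt.
  - specialize (Hm m (le_n m)). specialize (H m x Hx).
    rewrite (Rabs_pos_eq (_ ^ _)) in Hm by (apply pow_le; lra). lra.
Qed.

End Contraction.

Lemma rpow_pos (x a : R) : 0 < x -> rpow x a = Rpower x a.
Proof. intros H. unfold rpow. now destruct (Rlt_dec 0 x). Qed.

Lemma little_o_rel_dev (kappa : R) (h : R -> R) :
  filterlim (fun x => h x / (kappa * x ^ 2)) (at_right 0) (locally 1) ->
  little_o 0 (rel_dev kappa h).
Proof.
  intros H eps He.
  destruct (proj1 (filterlim_locally _ _) H (mkposreal eps He)) as ([e He'] & Hd).
  exists e. split; [easy|]. intros x Hx. simpl pow. rewrite Rmult_1_r. left.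
  apply (Hd x); [|easy]. unfold ball. simpl. unfold AbsRing_ball, abs, minus, plus, opp. simpl.
  rewrite Rabs_pos_eq; lra.
Qed.

Lemma Cm_open_third_derive (f : R -> R) (d : R) :
  Cm_open 3 f 0 d -> third_derive_on f (Derive_n f 3) d.
Proof.
  intros H. exists (Derive_n f 1), (Derive_n f 2).
  split; [|split]; intros x Hx; apply Derive_correct.
  - exact (proj1 (H x Hx 1%nat ltac:(lia))).
  - exact (proj1 (H x Hx 2%nat ltac:(lia))).
  - exact (proj1 (H x Hx 3%nat ltac:(lia))).
Qed.

Lemma ode_solved (n : R) (h : R -> R) (d x : R) :
  ode_on n h d -> 0 < x < d -> Derive_n h 3 x = (x - 1) * Rpower (h x) (1 - n).
Proof.
  intros H Hx. specialize (H x Hx).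
  replace (1 - n) with (- (n - 1)) by ring. rewrite Rpower_Ropp.
  assert (P := Rpower_pos (h x) (n - 1)).
  apply Rmult_eq_reg_l with (Rpower (h x) (n - 1)); [|lra].
  rewrite H. field. lra.
Qed.

(** Only the interval is adapted to [kappa] and [h]: [e] is chosen small enough for all hypotheses
    of the contraction. *)
Lemma vser_kappa_independent (n : R) : 0 < n < 3 / 2 -> kappa_independent n (vser n).
Proof.
  intros Hn kappa h Hk (d & Hd & HC & Hpos & Hode & H0 & Hlim).
  apply little_o_rel_dev in Hlim.
  destruct (Hlim (1 / 2) ltac:(lra)) as (e1 & He1 & H1).
  destruct (var2_small n kappa (rho n) Hn (rho_pos n Hn)) as (e2 & He2 & H2).
  assert (Hi := indicial_pos _ (beta_pos n Hn)).
  destruct (var2_small n kappa (indicial (beta n) / 16) Hn ltac:(lra)) as (e3 & He3 & H3).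
  set (e := Rmin (Rmin d 1) (Rmin (Rmin e1 e2) e3)).
  assert (He : 0 < e) by (repeat apply Rmin_glb_lt; lra).
  assert (B1 : e <= d) by (eapply Rle_trans; [apply Rmin_l | apply Rmin_l]).
  assert (B2 : e <= 1) by (eapply Rle_trans; [apply Rmin_l | apply Rmin_r]).
  assert (B3 : e <= e1) by (eapply Rle_trans; [apply Rmin_r | eapply Rle_trans; [apply Rmin_l | apply Rmin_l]]).
  assert (B4 : e <= e2) by (eapply Rle_trans; [apply Rmin_r | eapply Rle_trans; [apply Rmin_l | apply Rmin_r]]).
  assert (B5 : e <= e3) by (eapply Rle_trans; [apply Rmin_r | apply Rmin_r]).
  (* The defect vanishes on the open interval [(0, e)], while the expansion is stated on a closed
     one. *)
  exists (e / 2). split; [lra|]. intros x [[Hx|<-] Hx'].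
  (* At [x = 0] the prefactor [x ^ 2] vanishes, whatever the value of [v]. *)
  2:{ rewrite H0. ring. }
  rewrite !rpow_pos by easy.
  replace (Rpower kappa (- n) * Rpower x (beta n + 1)) with (var1 n kappa x)
    by (unfold var1, var2; rewrite Rpower_plus, Rpower_1 by easy; ring).
  fold (var2 n kappa x).
  rewrite (rel_devE kappa h x) by easy. do 2 f_equal.
  apply Rminus_diag_uniq.
  apply (defect_zero n kappa e h (Derive_n h 3)); try easy; try (intros y Hy).
  - apply third_derive_on_restrict with d; [easy|]. now apply Cm_open_third_derive.
  - apply Hpos. lra.
  - apply ode_solved with d; [easy|lra].
  - specialize (H1 y ltac:(lra)). simpl pow in H1. lra.
  - apply H2. lra.
  - specialize (H3 y ltac:(lra)). lra.
  - lra.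
Qed.

(** * Leading order of the boundary-value problem *)

Lemma nonneg_from_zero (f f1 : R -> R) (d : R) :
  derive_on f f1 d -> little_o 0 f -> (forall x, 0 < x < d -> 0 <= f1 x) ->
  forall x, 0 < x < d -> 0 <= f x.
Proof.
  intros H1 Ho Hp x Hx. destruct (Rle_lt_dec 0 (f x)) as [H|H]; [easy|exfalso].
  destruct (Ho (- f x / 2)) as (e & He & Hb); [lra|].
  set (y := Rmin (x / 2) (e / 2)).
  assert (Hy : 0 < y) by (apply Rmin_glb_lt; lra).
  assert (Y1 : y <= x / 2) by apply Rmin_l. assert (Y2 : y <= e / 2) by apply Rmin_r.
  specialize (Hb y ltac:(lra)). simpl pow in Hb. apply Rabs_le_between in Hb.
  assert (f y <= f x); [|lra].
  apply increasing_of_derive with f1; [lra| |]; intros t Ht; [apply H1 | apply Hp]; lra.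
Qed.

Lemma little_o_minus (m : nat) (f g : R -> R) :
  little_o m f -> little_o m g -> little_o m (fun x => f x - g x).
Proof.
  intros Hf Hg eps He.
  destruct (Hf (eps / 2)) as (e1 & He1 & H1); [lra|].
  destruct (Hg (eps / 2)) as (e2 & He2 & H2); [lra|].
  exists (Rmin e1 e2). split; [now apply Rmin_glb_lt|].
  intros x [Hx Hx']. apply Rmin_Rgt in Hx' as [Ha Hb].
  specialize (H1 x ltac:(lra)). specialize (H2 x ltac:(lra)).
  apply Rabs_le_between in H1, H2. apply Rabs_le. lra.
Qed.

Lemma little_o_scal_pow (c : R) (m : nat) : little_o 0 (fun x => c * x ^ S m).
Proof.
  intros eps He. assert (P : 0 < Rabs c + 1) by (assert (H := Rabs_pos c); lra).
  exists (Rmin 1 (eps / (Rabs c + 1))). split.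
  { apply Rmin_glb_lt; [lra | now apply Rdiv_lt_0_compat]. }
  intros x [Hx Hx']. apply Rmin_Rgt in Hx' as [Ha Hb].
  assert (Q : x * (Rabs c + 1) <= eps) by (apply Rle_div_r; lra).
  assert (0 <= x ^ m <= 1) by (split; [apply pow_le; lra | rewrite <- (pow1 m); apply pow_incr; lra]).
  assert (x ^ S m <= x) by (simpl; nra).
  assert (0 < x ^ S m) by now apply pow_lt.
  assert (H2 := Rabs_pos c).
  rewrite Rabs_mult, (Rabs_pos_eq (x ^ S m)) by lra. simpl (x ^ 0).
  apply Rle_trans with (Rabs c * x); [apply Rmult_le_compat_l; lra | nra].
Qed.

(** Two integrations from 0: first of [f2 - a], then of [f1 - a * x]. *)
Lemma quadratic_lower_bound (f f1 f2 : R -> R) (d a : R) :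
  derive_on f f1 d -> derive_on f1 f2 d -> little_o 0 f -> little_o 0 f1 ->
  (forall x, 0 < x < d -> a <= f2 x) -> forall x, 0 < x < d -> a / 2 * x ^ 2 <= f x.
Proof.
  intros H1 H2 Ho Ho1 Ha.
  assert (Hf1 : forall x, 0 < x < d -> 0 <= f1 x - a * x ^ 1).
  { apply (nonneg_from_zero _ (fun x => f2 x - a)).
    - apply derive_on_minus; [easy|]. intros x Hx. auto_derive; [easy | ring].
    - apply little_o_minus; [easy | apply little_o_scal_pow].
    - intros x Hx. specialize (Ha x Hx). lra. }
  intros x Hx. enough (0 <= f x - a / 2 * x ^ 2) by lra. revert x Hx.
  apply (nonneg_from_zero _ (fun x => f1 x - a * x ^ 1)); [| |easy].
  - apply derive_on_minus; [easy|]. intros x Hx. auto_derive; [easy | field].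
  - apply little_o_minus; [easy | apply little_o_scal_pow].
Qed.

Lemma quadratic_upper_bound (f f1 f2 : R -> R) (d a : R) :
  derive_on f f1 d -> derive_on f1 f2 d -> little_o 0 f -> little_o 0 f1 ->
  (forall x, 0 < x < d -> f2 x <= a) -> forall x, 0 < x < d -> f x <= a / 2 * x ^ 2.
Proof.
  intros H1 H2 Ho Ho1 Ha x Hx.
  enough (- a / 2 * x ^ 2 <= - f x) by lra. revert x Hx.
  apply (quadratic_lower_bound _ (fun x => - f1 x) (fun x => - f2 x)).
  1,2: intros x Hx; apply (@is_derive_opp R_AbsRing R_NormedModule); auto.
  - intros eps He. destruct (Ho eps He) as (e & He' & Hb).
    exists e. split; [easy|]. intros x Hx. rewrite Rabs_Ropp. auto.
  - intros eps He. destruct (Ho1 eps He) as (e & He' & Hb).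
    exists e. split; [easy|]. intros x Hx. rewrite Rabs_Ropp. auto.
  - intros x Hx. specialize (Ha x Hx). lra.
Qed.

(** At interior points the derivative relative to [[0, 1]] is the ordinary one; this transfers the
    behaviour of [dH] at 0 to [Derive H]. *)
Lemma C1_closed_interior (f df : R -> R) (x : R) :
  C1_closed f df 0 1 -> 0 < x < 1 -> Derive f x = df x.
Proof.
  intros HC Hx. apply is_derive_unique, is_derive_Reals.
  destruct (HC x ltac:(lra)) as [HD _].
  intros eps He. destruct (HD eps He) as (e & He' & Hb). simpl in Hb.
  assert (Hm : 0 < Rmin e (Rmin x (1 - x))) by (repeat apply Rmin_glb_lt; lra).
  exists (mkposreal _ Hm). simpl. intros h Hh Hh'.
  apply Rmin_Rgt in Hh' as [Ha Hb']. apply Rmin_Rgt in Hb' as [Hb1 Hb2].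
  apply Rabs_lt_between in Hb1, Hb2.
  assert (Q := Hb (x + h)). unfold Rdist in Q.
  replace (x + h - x) with h in Q by ring. apply Q.
  split; [|easy]. split; [lra | intros E; apply Hh; lra].
Qed.

Lemma continue_in_little_o (f : R -> R) (d : R) : 0 < d ->
  continue_in f (fun y => 0 <= y <= d) 0 -> f 0 = 0 -> little_o 0 f.
Proof.
  intros Hd Hc H0 eps He. destruct (Hc eps He) as (e & He' & Hb). simpl in Hb.
  exists (Rmin e d). split; [now apply Rmin_glb_lt|].
  intros x [Hx Hx']. apply Rmin_Rgt in Hx' as [Ha Hb'].
  assert (Q := Hb x). unfold Rdist in Q. rewrite H0, !Rminus_0_r in Q.
  simpl. rewrite Rmult_1_r. left. apply Q. rewrite Rabs_pos_eq by lra.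
  repeat split; lra.
Qed.

(* The primitive of [C * x ^ (g - 1)] stays bounded at 0. *)
Lemma bounded_above_near_zero (f f1 : R -> R) (d C g : R) : 0 < d -> 0 <= C -> 0 < g ->
  derive_on f f1 d -> (forall x, 0 < x < d -> - (C * Rpower x (g - 1)) <= f1 x) ->
  exists M, forall x, 0 < x <= d / 2 -> f x <= M.
Proof.
  intros Hd HC Hg H1 Hb. exists (f (d / 2) + C / g * Rpower (d / 2) g).
  intros x Hx.
  assert (HCg : 0 <= C / g) by (apply Rdiv_le_0_compat; lra).
  assert (P := Rpower_pos x g).
  enough (f x + C / g * Rpower x g <= f (d / 2) + C / g * Rpower (d / 2) g) by nra.
  apply (increasing_of_derive (fun t => f t + C / g * Rpower t g)
    (fun t => f1 t + C / g * g * Rpower t (g - 1))); [lra| |].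
  - intros t Ht. apply (@is_derive_plus R_AbsRing R_NormedModule).
    + apply H1. lra.
    + apply is_derive_Rpower. lra.
  - intros t Ht. specialize (Hb t ltac:(lra)).
    replace (C / g * g) with C by (field; lra). lra.
Qed.

(** The limit is the supremum of the values. *)
Lemma decreasing_limit_at_zero (f : R -> R) (d M : R) : 0 < d ->
  (forall x y, 0 < x -> x <= y -> y < d -> f y <= f x) ->
  (forall x, 0 < x < d -> f x <= M) ->
  exists L, (forall x, 0 < x < d -> f x <= L) /\ little_o 0 (fun x => f x - L).
Proof.
  intros Hd Hdec HM.
  destruct (completeness (fun z => exists x, 0 < x < d /\ z = f x)) as (L & HL1 & HL2).
  - exists M. intros z (x & Hx & ->). now apply HM.
  - exists (f (d / 2)), (d / 2). split; [lra | easy].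
  - assert (Hle : forall x, 0 < x < d -> f x <= L) by (intros x Hx; apply HL1; now exists x).
    exists L. split; [easy|]. intros eps He.
    destruct (classic (exists x, 0 < x < d /\ L - eps < f x)) as [(x0 & Hx0 & H0)|Hno].
    + exists x0. split; [easy|]. intros x Hx. simpl pow.
      assert (A1 := Hdec x x0 ltac:(lra) ltac:(lra) ltac:(lra)).
      assert (A2 := Hle x ltac:(lra)). apply Rabs_le. lra.
    + exfalso. assert (L <= L - eps); [|lra].
      apply HL2. intros z (x & Hx & ->). apply Rnot_lt_le. intros H. apply Hno. now exists x.
Qed.

(** For [n <= 1] the power is at most 1 because [H <= 1]. For [n > 1] it decreases in [H], so
    [H >= c * x ^ 2] bounds it by a multiple of [x ^ (beta - 1)], integrable at 0 since
    [n < 3 / 2]. *)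
Lemma rhs_lower_bound (n c d : R) (H : R -> R) : 0 < n < 3 / 2 -> 0 < c -> 0 < d <= 1 ->
  (forall x, 0 < x < d -> c * x ^ 2 <= H x <= 1) ->
  exists C g, 0 <= C /\ 0 < g /\
    forall x, 0 < x < d -> - (C * Rpower x (g - 1)) <= (x - 1) * Rpower (H x) (1 - n).
Proof.
  intros Hn Hc Hd HH.
  enough (exists C g, 0 <= C /\ 0 < g /\
    forall x, 0 < x < d -> Rpower (H x) (1 - n) <= C * Rpower x (g - 1)) as (C & g & HC & Hg & Hb).
  { exists C, g. split; [easy|]. split; [easy|]. intros x Hx. specialize (Hb x Hx).
    assert (P := Rpower_pos (H x) (1 - n)). nra. }
  assert (Hcx : forall x, 0 < x -> 0 < c * x ^ 2)
    by (intros x Hx; apply Rmult_lt_0_compat; [easy | now apply pow_lt]).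
  destruct (Rle_lt_dec n 1) as [Hn1|Hn1].
  - exists 1, 1. repeat split; try lra. intros x Hx.
    assert (HHx := HH x Hx). assert (Hcx' := Hcx x ltac:(lra)).
    rewrite Rminus_diag, Rpower_O, Rmult_1_r by lra.
    replace 1 with (Rpower 1 (1 - n)) at 2 by (unfold Rpower; now rewrite ln_1, Rmult_0_r, exp_0).
    apply Rle_Rpower_l; lra.
  - exists (Rpower c (1 - n)), (beta n).
    split; [apply Rlt_le, Rpower_pos|]. split; [now apply beta_pos|]. intros x Hx.
    assert (HHx := HH x Hx). assert (Hcx' := Hcx x ltac:(lra)).
    replace (Rpower c (1 - n) * Rpower x (beta n - 1)) with (Rpower (c * x ^ 2) (1 - n)).
    + replace (1 - n) with (- (n - 1)) by ring. rewrite !Rpower_Ropp.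
      apply Rinv_le_contravar; [apply Rpower_pos|]. apply Rle_Rpower_l; lra.
    + rewrite <- Rpower_mult_distr by (easy || (apply pow_lt; lra)).
      rewrite <- (Rpower_pow 2 x), Rpower_mult by lra. do 2 f_equal.
      unfold beta. simpl. ring.
Qed.

Lemma bvp_leading_order (n : R) (H : R -> R) : 0 < n < 3 / 2 -> bvp_solution n H ->
  exists kappa, 0 < kappa /\ local_solution n kappa H.
Proof.
  intros Hn (dH & HC1 & HC3 & Hpos & Hode & H0 & HdH0 & _).
  set (H1 := Derive_n H 1). set (H2 := Derive_n H 2). set (H3 := Derive_n H 3).
  assert (D0 : derive_on H H1 1)
    by (intros x Hx; apply Derive_correct; exact (proj1 (HC3 x Hx 1%nat ltac:(lia)))).
  assert (D1 : derive_on H1 H2 1)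
    by (intros x Hx; apply Derive_correct; exact (proj1 (HC3 x Hx 2%nat ltac:(lia)))).
  assert (D2 : derive_on H2 H3 1)
    by (intros x Hx; apply Derive_correct; exact (proj1 (HC3 x Hx 3%nat ltac:(lia)))).
  destruct (HC1 0 ltac:(lra)) as [HD0 HdHc].
  assert (o0 : little_o 0 H).
  { apply continue_in_little_o with 1; [lra| |easy]. now apply cont_deriv with dH. }
  assert (o1 : little_o 0 H1).
  { assert (o := continue_in_little_o dH 1 ltac:(lra) HdHc HdH0).
    intros eps He. destruct (o eps He) as (e & He' & Hb). exists (Rmin e 1).
    split; [apply Rmin_glb_lt; lra|]. intros x [Hx Hx']. apply Rmin_Rgt in Hx' as [Ha Hb'].
    unfold H1. simpl Derive_n. change (Derive (fun x => H x) x) with (Derive H x).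
    rewrite (C1_closed_interior H dH) by (easy || lra). apply Hb. lra. }
  assert (E3 : forall x, 0 < x < 1 -> H3 x = (x - 1) * Rpower (H x) (1 - n))
    by (intros x Hx; now apply ode_solved with 1).
  assert (Hdec : forall x y, 0 < x -> x <= y -> y < 1 -> H2 y <= H2 x).
  { intros x y Hx Hxy Hy. apply Ropp_le_cancel.
    apply (increasing_of_derive (fun t => - H2 t) (fun t => - H3 t)); [easy| |].
    - intros t Ht. apply (@is_derive_opp R_AbsRing R_NormedModule), D2. lra.
    - intros t Ht. rewrite E3 by lra. assert (P := Rpower_pos (H t) (1 - n)). nra. }
  assert (Hx0 : exists x0, 0 < x0 < 1 /\ 0 < H2 x0).
  { apply NNPP. intros Hno.
    assert (Hle : forall x, 0 < x < 1 -> H2 x <= 0).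
    { intros x Hx. apply Rnot_lt_le. intros Hlt. apply Hno. now exists x. }
    assert (B := quadratic_upper_bound H H1 H2 1 0 D0 D1 o0 o1 Hle (1 / 2) ltac:(lra)).
    assert (P := Hpos (1 / 2) ltac:(lra)). lra. }
  destruct Hx0 as (x0 & Hx0 & Hc). set (c := H2 x0) in *.
  assert (restrict : forall f f' e, e <= 1 -> derive_on f f' 1 -> derive_on f f' e)
    by (intros f f' e He Hf x Hx; apply Hf; lra).
  assert (Hlow : forall x, 0 < x < x0 -> c / 2 * x ^ 2 <= H x).
  { apply (quadratic_lower_bound H H1 H2); try (apply restrict; [lra|]); try assumption.
    intros x Hx. apply Hdec; lra. }
  (* This provides [H <= 1] near 0 for [rhs_lower_bound]. *)
  destruct (o0 1 ltac:(lra)) as (e & He & Hup).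
  set (d := Rmin x0 e).
  assert (Hd : 0 < d) by (apply Rmin_glb_lt; lra).
  assert (Hd1 : d <= x0) by apply Rmin_l. assert (Hd2 : d <= e) by apply Rmin_r.
  destruct (rhs_lower_bound n (c / 2) d H Hn) as (C & g & HC & Hg & Hb); [lra | lra | |].
  { intros x Hx. specialize (Hup x ltac:(lra)). simpl (x ^ 0) in Hup.
    apply Rabs_le_between in Hup. split; [apply Hlow|]; lra. }
  destruct (bounded_above_near_zero H2 H3 d C g Hd HC Hg) as (M & HM).
  { apply restrict; [lra | easy]. }
  { intros x Hx. rewrite E3 by lra. now apply Hb. }
  destruct (decreasing_limit_at_zero H2 (d / 2) M) as (L & HL & oL); [lra | | |].
  { intros x y Hx Hxy Hy. apply Hdec; lra. }
  { intros x Hx. apply HM. lra. }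
  assert (HcL : c <= L).
  { apply Rle_trans with (H2 (d / 4)); [apply Hdec; lra | apply HL; lra]. }
  (* [L] is the limit of the second derivative at 0, positive because [L >= c]. *)
  exists (L / 2). split; [lra|]. exists 1.
  split; [lra|]. split; [easy|]. split; [intros x Hx; apply Hpos; lra|].
  split; [easy|]. split; [easy|].
  apply filterlim_locally. intros [eps Heps]. simpl.
  (* A relative error of [eps / 2] in the second derivative carries over to [H / (L / 2 * x ^ 2)];
     the half yields the strict inequality of the ball. *)
  destruct (oL (eps * L / 2)) as (e' & He' & Hb'); [nra|].
  assert (Hm : 0 < Rmin e' 1) by (apply Rmin_glb_lt; lra).
  exists (mkposreal _ Hm). intros x Hx Hx0'.
  unfold ball in *. simpl in *. unfold AbsRing_ball, abs, minus, plus, opp in *. simpl in *.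
  rewrite Rabs_pos_eq in Hx by lra.
  assert (Hxm : x < Rmin e' 1) by lra. clear Hx.
  assert (Hm1 : Rmin e' 1 <= e') by apply Rmin_l. assert (Hm2 : Rmin e' 1 <= 1) by apply Rmin_r.
  assert (Hbb : forall t, 0 < t < Rmin e' 1 -> L - eps * L / 2 <= H2 t <= L + eps * L / 2).
  { intros t Ht. specialize (Hb' t ltac:(lra)). rewrite Rmult_1_r in Hb'.
    apply Rabs_le_between in Hb'. lra. }
  assert (B1 := quadratic_lower_bound H H1 H2 (Rmin e' 1) (L - eps * L / 2)
    (restrict _ _ _ Hm2 D0) (restrict _ _ _ Hm2 D1) o0 o1
    (fun t Ht => proj1 (Hbb t Ht)) x (conj Hx0' Hxm)).
  assert (B2 := quadratic_upper_bound H H1 H2 (Rmin e' 1) (L + eps * L / 2)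
    (restrict _ _ _ Hm2 D0) (restrict _ _ _ Hm2 D1) o0 o1
    (fun t Ht => proj2 (Hbb t Ht)) x (conj Hx0' Hxm)).
  assert (Hx2 : 0 < x ^ 2) by now apply pow_lt.
  assert (HLx : 0 < L / 2 * x ^ 2) by nra.
  change (x * (x * 1)) with (x ^ 2).
  assert (Q1 : H x / (L / 2 * x ^ 2) <= 1 + eps / 2).
  { apply Rle_div_l; [easy|]. lra. }
  assert (Q2 : 1 - eps / 2 <= H x / (L / 2 * x ^ 2)).
  { apply Rle_div_r; [easy|]. lra. }
  apply Rabs_lt_between. lra.
Qed.

Theorem theorem3p1 :
  exists v : R -> R -> R -> R,
    (forall n : R, 0 < n < 3 / 2 ->
       analytic_near_origin (v n) /\
       v n 0 0 = 0 /\
       not_identically_zero (v n) /\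
       kappa_independent n (v n) /\
       (forall H : R -> R, bvp_solution n H ->
          exists kappa : R, 0 < kappa /\ expansion n (v n) kappa H)) /\
    (exists n : R, 0 < n < 3 / 2 /\
       depends_on_fst (v n) /\ depends_on_snd (v n)).
Proof.
  exists vser. split.
  - intros n Hn. split; [|split; [|split; [|split]]].
    + now apply vser_analytic.
    + now apply vser_0.
    + now apply depends_on_fst_nonzero, vser_depends_on_fst.
    + now apply vser_kappa_independent.
    + intros H HH. destruct (bvp_leading_order n H Hn HH) as (kappa & Hk & Hl).
      exists kappa. split; [easy|]. now apply vser_kappa_independent.
  (* At [n = 1] the equation is linear in [H] and [v = x1 / 24 - x2 / 6]. *)
  - exists 1. split; [lra|]. split.
    + apply vser_depends_on_fst. lra.
    + apply vser_depends_on_snd. lra.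
Qed.
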